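(* Let $V$ be the vector representation of $U_{r,s}(\mathfrak{so}_{2n+1})$ and let $R_{V,V}=\Theta\circ\tilde f\circ P:V\otimes V\to V\otimes V$ (all defined in the context). Then \begin{align*} R_{V,V}=\;& r^{-1}s\sum_{i\neq i'}E_{ii}\otimes E_{ii} +r^{-1}s^{-1}\Bigl(\sum_{(i,j)\in A}E_{ij}\otimes E_{ji}+\sum_{(i,j)\in B}E_{ji}\otimes E_{ij}\Bigr)\\ &+rs\Bigl(\sum_{(i,j)\in A}E_{ji}\otimes E_{ij}+\sum_{(i,j)\in B}E_{ij}\otimes E_{ji}\Bigr)\\ &+\sum_{i\ne i'}E_{i,n+1}\otimes E_{n+1,i}+\sum_{j\neq j'}E_{n+1,j}\otimes E_{j,n+1}+rs^{-1}\sum_{i\neq i'}E_{i'i}\otimes E_{ii'}\\ &+(r^{-1}s-rs^{-1})\Bigl\{\sum_{i>j}E_{ii}\otimes E_{jj}-\sum_{i>j}(r^{-1}s)^{\rho_i-\rho_j}E_{ij'}\otimes E_{i'j}\Bigr\}+E_{n+1,n+1}\otimes E_{n+1,n+1}, \end{align*} where indices $i,j$ run over $1,\dots,2n+1$ unless otherwise restricted, $A=\{(i,j):1\le i\le n,\ i+1\le j\le n\}\cup\{(i,j):2\le i\le n,\ (i-1)'\le j\le 1'\}$, $B=\{(i,j):1\le i\le n-1,\ n'\le j\le (i+1)'\}\cup\{(i,j):n'\le i\le 2',\ i+1\le j\le 1'\}$, and $\rho_i=\frac{2n+1}{2}-i$ for $i<n+1$, $\rho_i=-\rho_{i'}$ for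 $i\ge n+1$.
   Context: Let $n\ge 2$, $r,s$ algebraically independent indeterminates, $\mathbb K$ a field extension of $\mathbb Q(r,s)$ containing $\sqrt r,\sqrt s,\sqrt{r+s}$. Put $r_i=r^2,s_i=s^2$ for $1\le i\le n-1$, $r_n=r,s_n=s$. Structure constants $\langle\omega_i',\omega_j\rangle$ ($1\le i,j\le n$): $\langle\omega_i',\omega_i\rangle=r^2s^{-2}$ for $i<n$, $\langle\omega_n',\omega_n\rangle=rs^{-1}$, $\langle\omega_i',\omega_{i+1}\rangle=r^{-2}$, $\langle\omega_{i+1}',\omega_i\rangle=s^2$, all others $1$; extended bimultiplicatively to the root lattice. $U_{r,s}(\mathfrak{so}_{2n+1})$ is the unital $\mathbb K$-algebra generated by $e_i,f_i,\omega_i^{\pm1},(\omega_i')^{\pm1}$ ($1\le i\le n$) with relations: all $\omega_i^{\pm1},(\omega_j')^{\pm1}$ commute, $\omega_i\omega_i^{-1}=\omega_i'(\omega_i')^{-1}=1$; $\omega_je_i\omega_j^{-1}=\langle\omega_i',\omega_j\rangle e_i$, $\omega_jf_i\omega_j^{-1}=\langle\omega_i',\omega_j\rangle^{-1}f_i$, $\omega_j'e_i(\omega_j')^{-1}=\langle\omega_j',\omega_i\rangle^{-1}e_i$, $\omega_j'f_i(\omega_j')^{-1}=\langle\omega_j',\omega_i\rangle f_i$; $[e_i,f_j]=\frac{\delta_{ij}}{r_i-s_i}(\omega_i-\omega_i')$; and for $i\ne j$ the Serre relations $(\mathrm{ad}_l e_i)^{1-a_{ij}}(e_j)=0$, $(\mathrm{ad}_r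 f_i)^{1-a_{ij}}(f_j)=0$, where $\mathrm{ad}_le_i(b)=e_ib-\omega_ib\omega_i^{-1}e_i$, $\mathrm{ad}_rf_i(b)=bf_i-f_i(\omega_i')^{-1}b\,\omega_i'$ and $(a_{ij})$ is the Cartan matrix of type $B_n$ ($a_{n,n-1}=-2$, $a_{n-1,n}=-1$). Coproduct: $\Delta(e_i)=e_i\otimes1+\omega_i\otimes e_i$, $\Delta(f_i)=1\otimes f_i+f_i\otimes\omega_i'$, $\omega_i,\omega_i'$ group-like. Vector representation: $i'=2n+2-i$; $V$ has basis $v_1,\dots,v_{2n+1}$, $E_{ij}$ are matrix units ($E_{ij}v_j=v_i$). For $1\le i\le n-1$: $e_i\mapsto E_{i,i+1}-(rs)^{-1}E_{(i+1)',i'}$, $f_i\mapsto E_{i+1,i}-(rs)^{-1}E_{i',(i+1)'}$, $\omega_i\mapsto r^2E_{ii}+s^2E_{i+1,i+1}+s^{-2}E_{(i+1)',(i+1)'}+r^{-2}E_{i'i'}+\sum_{j\ne i,i+1,i',(i+1)'}E_{jj}$, $\omega_i'\mapsto$ the same with $r\leftrightarrow s$. Further $e_n\mapsto(r+s)^{1/2}((rs)^{-1/2}E_{n,n+1}-r^{-1}E_{n+1,n'})$, $f_n\mapsto(r+s)^{1/2}((rs)^{-1/2}E_{n+1,n}-s^{-1}E_{n',n+1})$, $\omega_n\mapsto rs^{-1}E_{nn}+E_{n+1,n+1}+r^{-1}sE_{n'n'}+(rs)^{-1}\sum_{j\le n-1}E_{jj}+rs\sum_{j\ge(n-1)'}E_{jj}$,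 $\omega_n'\mapsto r^{-1}sE_{nn}+E_{n+1,n+1}+rs^{-1}E_{n'n'}+(rs)^{-1}\sum_{j\le n-1}E_{jj}+rs\sum_{j\ge(n-1)'}E_{jj}$. The weight of $v_i$ is $\varepsilon_i=\alpha_i+\dots+\alpha_n$ for $i\le n$, $0$ for $i=n+1$, and $-\varepsilon_i$ for $v_{i'}$, $i\le n$. The map $R_{V,V}$: $P(v\otimes w)=w\otimes v$. For $v,w$ of weights $\lambda,\mu$, $\tilde f(v\otimes w)=\langle\omega'_\mu,\omega_\lambda\rangle^{-1}v\otimes w$. Let $\langle\,,\rangle$ be the skew pairing between the Hopf subalgebra generated by the $f_i,(\omega_i')^{\pm1}$ and the one generated by the $e_i,\omega_i^{\pm1}$, with $\langle f_i,e_j\rangle=\frac{\delta_{ij}}{s_i-r_i}$, the given values $\langle\omega_i',\omega_j\rangle$, $\langle f_i,\omega_j\rangle=\langle\omega_i',e_j\rangle=0$, $\langle y,xx'\rangle=\langle\Delta^{op}(y),x\otimes x'\rangle$, $\langle yy',x\rangle=\langle y\otimes y',\Delta(x)\rangle$. Then $\Theta=\sum_{\zeta}\Theta_\zeta$ over $\zeta\in\sum_i\mathbb Z_{\ge0}\alpha_i$, where $\Theta_\zeta=\sum_kv_k^\zeta\otimes u_k^\zeta$ with $\{u_k^\zeta\}$ a basis of the weight-$\zeta$ part $U^+_\zeta$ of the subalgebra generated by the $e_i$ and $\{v_k^\zeta\}$ the dual basis of the weight-$(-\zeta)$ part of the subalgebra generated by the $f_i$ (so $\Theta_0=1\otimes1$,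 $\Theta_{\alpha_i}=(s_i-r_i)f_i\otimes e_i$); $\Theta$ acts on $V\otimes V$ as a finite sum. *)

(* Defs.v *)
From Stdlib Require List.
From HB Require Import structures.
From mathcomp Require Import all_boot all_order all_algebra.
From mathcomp Require Import boolp classical_sets fsbigop.
From mathcomp.real_closed Require Import mxtens.

Set Implicit Arguments.
Unset Strict Implicit.
Unset Printing Implicit Defensive.

Import GRing.Theory.
Local Open Scope quotient_scope.
Local Open Scope ring_scope.

(* r and s are algebraically independent over the prime field Q of K, so that
   K is an extension of Q(r,s). *)
Definition alg_independent (K : fieldType) (r s : K) : Prop :=
  [pchar K] =i pred0 /\
  forall p : {poly {poly rat}}, p != 0 ->
    (map_poly (map_poly (ratr : rat -> K)) p).[r%:P].[s] != 0.

(* Subalgebra of A generated by a set S. *)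
Inductive subalg (K : fieldType) (A : algType K) (S : A -> Prop) : A -> Prop :=
| subalg_gen x : S x -> subalg S x
| subalg_one : subalg S 1
| subalg_lin (c : K) x y : subalg S x -> subalg S y -> subalg S (c *: x + y)
| subalg_mul x y : subalg S x -> subalg S y -> subalg S (x * y).

Lemma subalg_const (K : fieldType) (A : algType K) (S : A -> Prop) (c : K) :
  subalg S c%:A.
Proof.
rewrite -[c%:A]addr0; apply: subalg_lin; first exact: subalg_one.
rewrite -(addNr 1) -scaleN1r; apply: subalg_lin; exact: subalg_one.
Qed.

Inductive span (K : fieldType) (W : lmodType K) (S : W -> Prop) : W -> Prop :=
| span_zero : span S 0
| span_lin (c : K) x y : S x -> span S y -> span S (c *: x + y).

Definition is_basis (K : fieldType) (A : lmodType K) (P : A -> Prop)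
    (d : nat) (b : 'I_d -> A) : Prop :=
  [/\ forall k, P (b k),
      forall x, P x -> exists c : 'I_d -> K, x = \sum_k c k *: b k
    & forall c : 'I_d -> K, \sum_k c k *: b k = 0 -> forall k, c k = 0].

(* Tensor product of two algebras: formal sums of pairs, two of them being
   identified when every bilinear map (into any K-space) agrees on them. *)
Section Tensor.
Variables (K : fieldType) (A B : algType K).

Definition bilinear_map (W : lmodType K) (b : A -> B -> W) : Prop :=
  (forall y, linear (fun x => b x y)) /\ (forall x, linear (b x)).

Definition tens_val (W : lmodType K) (b : A -> B -> W) (t : seq (A * B)) : W :=
  \sum_(p <- t) b p.1 p.2.

Definition tens_rel (t t' : seq (A * B)) : bool :=
  `[< forall (W : lmodType K) (b : A -> B -> W),
        bilinear_map b -> tens_val b t = tens_val b t' >].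

Lemma tens_relP t t' :
  reflect (forall (W : lmodType K) (b : A -> B -> W),
            bilinear_map b -> tens_val b t = tens_val b t') (tens_rel t t').
Proof. exact: asboolP. Qed.

Lemma tens_rel_equiv : equiv_class_of tens_rel.
Proof.
split=> [t|t t'|t u v].
- by apply/tens_relP.
- by apply/tens_relP/tens_relP => H W b hb; rewrite H.
- by move=> /tens_relP H1 /tens_relP H2; apply/tens_relP => W b hb; rewrite H1 // H2.
Qed.

Canonical tens_equiv := EquivRelPack tens_rel_equiv.

Definition tens := {eq_quot tens_equiv}.
HB.instance Definition _ := Choice.on tens.
HB.instance Definition _ := EqQuotient.on tens.

Definition tensor (a : A) (b : B) : tens := \pi_tens [:: (a, b)].

Lemma tens_eqP t t' :
  reflect (forall (W : lmodType K) (b : A -> B -> W),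
            bilinear_map b -> tens_val b t = tens_val b t')
          (\pi_tens t == \pi_tens t').
Proof. by apply: (iffP eqP) => [/eqmodP/tens_relP|H]; [|apply/eqmodP/tens_relP]. Qed.

Lemma tens_reprE t (W : lmodType K) (b : A -> B -> W) :
  bilinear_map b -> tens_val b (repr (\pi_tens t)) = tens_val b t.
Proof. by apply/tens_eqP; rewrite reprK. Qed.

Definition topp (t : seq (A * B)) := [seq (- p.1, p.2) | p <- t].
Definition tscale (c : K) (t : seq (A * B)) := [seq (c *: p.1, p.2) | p <- t].
Definition tmul (t t' : seq (A * B)) :=
  [seq (p.1 * q.1, p.2 * q.2) | p <- t, q <- t'].

Lemma bilinear_mapDl (W : lmodType K) (b : A -> B -> W) : bilinear_map b ->
  forall x x' y, b (x + x') y = b x y + b x' y.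
Proof. by case=> h _ x x' y; move: (h y 1 x x'); rewrite !scale1r. Qed.

Lemma bilinear_map0l (W : lmodType K) (b : A -> B -> W) : bilinear_map b ->
  forall y, b 0 y = 0.
Proof.
move=> hb y; have := bilinear_mapDl hb 0 0 y.
by rewrite addr0 -{1}[b 0 y]addr0 => /addrI.
Qed.

Lemma bilinear_mapZl (W : lmodType K) (b : A -> B -> W) : bilinear_map b ->
  forall c x y, b (c *: x) y = c *: b x y.
Proof.
move=> hb c x y; case: (hb) => h _; move: (h y c x 0).
by rewrite !addr0 bilinear_map0l // addr0.
Qed.

Lemma bilinear_mapNl (W : lmodType K) (b : A -> B -> W) : bilinear_map b ->
  forall x y, b (- x) y = - b x y.
Proof. by move=> hb x y; rewrite -[- x]scaleN1r bilinear_mapZl // scaleN1r. Qed.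

Lemma tens_val_cat (W : lmodType K) (b : A -> B -> W) t t' :
  tens_val b (t ++ t') = tens_val b t + tens_val b t'.
Proof. by rewrite /tens_val big_cat. Qed.

Lemma tens_val_opp (W : lmodType K) (b : A -> B -> W) t : bilinear_map b ->
  tens_val b (topp t) = - tens_val b t.
Proof.
move=> hb; rewrite /tens_val big_map -sumrN.
by apply: eq_bigr => p _; rewrite bilinear_mapNl.
Qed.

Lemma tens_val_scale (W : lmodType K) (b : A -> B -> W) c t : bilinear_map b ->
  tens_val b (tscale c t) = c *: tens_val b t.
Proof.
move=> hb; rewrite /tens_val big_map scaler_sumr.
by apply: eq_bigr => p _ /=; rewrite bilinear_mapZl.
Qed.

Lemma tens_val_mul (W : lmodType K) (b : A -> B -> W) t t' :
  tens_val b (tmul t t') =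
  \sum_(p <- t) \sum_(q <- t') b (p.1 * q.1) (p.2 * q.2).
Proof. by rewrite /tens_val big_allpairs_dep. Qed.

Lemma bilinear_mulr (W : lmodType K) (b : A -> B -> W) (t' : seq (A * B)) :
  bilinear_map b ->
  bilinear_map (fun x y => \sum_(q <- t') b (x * q.1) (y * q.2)).
Proof.
case=> h1 h2; split=> [y c x x'|x c y y'] /=;
  rewrite scaler_sumr -big_split /=; apply: eq_bigr => q _.
- by rewrite mulrDl -scalerAl h1.
- by rewrite mulrDl -scalerAl h2.
Qed.

Lemma bilinear_mull (W : lmodType K) (b : A -> B -> W) (t : seq (A * B)) :
  bilinear_map b ->
  bilinear_map (fun x y => \sum_(p <- t) b (p.1 * x) (p.2 * y)).
Proof.
case=> h1 h2; split=> [y c x x'|x c y y'] /=;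
  rewrite scaler_sumr -big_split /=; apply: eq_bigr => q _.
- by rewrite mulrDr -scalerAr h1.
- by rewrite mulrDr -scalerAr h2.
Qed.

Lemma tens_mul_reprl (W : lmodType K) (b : A -> B -> W) t t' :
  bilinear_map b ->
  tens_val b (tmul (repr (\pi_tens t)) t') = tens_val b (tmul t t').
Proof.
by move=> hb; rewrite !tens_val_mul; apply: (tens_reprE t (bilinear_mulr t' hb)).
Qed.

Lemma tens_mul_reprr (W : lmodType K) (b : A -> B -> W) t t' :
  bilinear_map b ->
  tens_val b (tmul t (repr (\pi_tens t'))) = tens_val b (tmul t t').
Proof.
move=> hb; rewrite !tens_val_mul exchange_big [RHS]exchange_big /=.
exact: (tens_reprE t' (bilinear_mull t hb)).
Qed.

Definition tens_add (x y : tens) : tens := \pi_tens (repr x ++ repr y).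
Definition tens_opp (x : tens) : tens := \pi_tens (topp (repr x)).
Definition tens_scale (c : K) (x : tens) : tens := \pi_tens (tscale c (repr x)).
Definition tens_mul (x y : tens) : tens := \pi_tens (tmul (repr x) (repr y)).

Lemma tens_addA : associative tens_add.
Proof.
move=> x y z; apply/eqP/tens_eqP => W b hb.
by rewrite !(tens_val_cat, tens_reprE) // addrA.
Qed.
Lemma tens_addC : commutative tens_add.
Proof. by move=> x y; apply/eqP/tens_eqP => W b hb; rewrite !tens_val_cat addrC. Qed.
Lemma tens_add0 : left_id (\pi_tens [::]) tens_add.
Proof.
move=> x; rewrite -[RHS]reprK; apply/eqP/tens_eqP => W b hb.
by rewrite tens_val_cat tens_reprE // /tens_val big_nil add0r.
Qed.
Lemma tens_addN : left_inverse (\pi_tens [::]) tens_opp tens_add.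
Proof.
move=> x; apply/eqP/tens_eqP => W b hb.
by rewrite tens_val_cat tens_reprE // tens_val_opp // addNr /tens_val big_nil.
Qed.

HB.instance Definition _ :=
  GRing.isZmodule.Build tens tens_addA tens_addC tens_add0 tens_addN.

Lemma tens_mulA : associative tens_mul.
Proof.
move=> x y z; apply/eqP/tens_eqP => W b hb.
rewrite tens_mul_reprl // tens_mul_reprr // !tens_val_mul.
rewrite big_allpairs_dep /=; apply: eq_bigr => p _.
rewrite big_allpairs_dep /=; apply: eq_bigr => q _; apply: eq_bigr => u _.
by rewrite !mulrA.
Qed.
Lemma tens_mul1l : left_id (tensor 1 1) tens_mul.
Proof.
move=> x; rewrite -[RHS]reprK; apply/eqP/tens_eqP => W b hb.
rewrite tens_mul_reprl // tens_val_mul big_seq1.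
by apply: eq_bigr => p _; rewrite !mul1r.
Qed.
Lemma tens_mul1r : right_id (tensor 1 1) tens_mul.
Proof.
move=> x; rewrite -[RHS]reprK; apply/eqP/tens_eqP => W b hb.
rewrite tens_mul_reprr // tens_val_mul.
by apply: eq_bigr => p _; rewrite big_seq1 !mulr1.
Qed.
Lemma tens_mulDl : left_distributive tens_mul tens_add.
Proof.
move=> x y z; apply/eqP/tens_eqP => W b hb.
by rewrite tens_mul_reprl // tens_val_cat !tens_reprE // !tens_val_mul big_cat.
Qed.
Lemma tens_mulDr : right_distributive tens_mul tens_add.
Proof.
move=> x y z; apply/eqP/tens_eqP => W b hb.
rewrite tens_mul_reprr // tens_val_cat !tens_reprE // !tens_val_mul -big_split /=.
by apply: eq_bigr => p _; rewrite big_cat.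
Qed.

HB.instance Definition _ := GRing.Zmodule_isPzRing.Build tens
  tens_mulA tens_mul1l tens_mul1r tens_mulDl tens_mulDr.

Lemma tens_scaleA c c' x : tens_scale c (tens_scale c' x) = tens_scale (c * c') x.
Proof.
apply/eqP/tens_eqP => W b hb.
by rewrite !(tens_val_scale, tens_reprE) // scalerA.
Qed.
Lemma tens_scale1 : left_id 1 tens_scale.
Proof.
move=> x; rewrite -[RHS]reprK; apply/eqP/tens_eqP => W b hb.
by rewrite tens_val_scale // scale1r.
Qed.
Lemma tens_scaleDr : right_distributive tens_scale +%R.
Proof.
move=> c x y; apply/eqP/tens_eqP => W b hb.
by rewrite !(tens_val_scale, tens_val_cat, tens_reprE) // scalerDr.
Qed.
Lemma tens_scaleDl x : {morph tens_scale^~ x : c c' / c + c'}.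
Proof.
move=> c c'; apply/eqP/tens_eqP => W b hb.
by rewrite !(tens_val_scale, tens_val_cat, tens_reprE) // scalerDl.
Qed.

HB.instance Definition _ := GRing.Zmodule_isLmodule.Build K tens
  tens_scaleA tens_scale1 tens_scaleDr tens_scaleDl.

Lemma tensor_mul a a' b b' :
  tensor a b * tensor a' b' = tensor (a * a') (b * b').
Proof.
apply/eqP/tens_eqP => W h hh.
by rewrite tens_mul_reprl // tens_mul_reprr // /tens_val.
Qed.

Lemma tensor_bilinear : bilinear_map tensor.
Proof.
split=> [b c a a'|a c b b']; apply/eqP/tens_eqP => W h hh;
  rewrite !(tens_val_cat, tens_val_scale, tens_reprE) // /tens_val !big_seq1 /=;
  by case: hh => h1 h2; rewrite ?h1 ?h2.
Qed.

End Tensor.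

Notation "a '⊗' b" := (tensor a b) (at level 40, left associativity) : ring_scope.

(* Indices 1..n of simple roots are 'I_n, shifted by one: i stands for i.+1. *)
Section Constants.
Variables (n : nat) (K : fieldType) (r s : K).
Implicit Types i j : 'I_n.

Definition rr i : K := if i.+1 == n then r else r ^+ 2.
Definition ss i : K := if i.+1 == n then s else s ^+ 2.

(* < omega'_i, omega_j > *)
Definition cst i j : K :=
  if i == j then (if i.+1 == n then r / s else r ^+ 2 / s ^+ 2)
  else if j == i.+1 :> nat then r ^- 2
  else if i == j.+1 :> nat then s ^+ 2
  else 1.

(* < omega'_l, omega_m > for l, m in the root lattice, given by coordinates in
   the simple roots *)
Definition cst_lattice (l m : 'I_n -> int) : K :=
  \prod_i \prod_j cst i j ^ (l i * m j).

Definition cartan i j : int :=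
  if i == j then 2
  else if (i == j.+1 :> nat) || (j == i.+1 :> nat) then
    (if i.+1 == n then - 2 else - 1)
  else 0.

End Constants.

(* The defining relations, for elements of an arbitrary algebra; wi and wpi
   are the elements omega_i^{-1} and (omega'_i)^{-1}. *)
Section Relations.
Variables (n : nat) (K : fieldType) (r s : K) (A : algType K).
Variables (e f w wi wp wpi : 'I_n -> A).

Definition ad_l (i : 'I_n) (b : A) : A := e i * b - w i * b * wi i * e i.
Definition ad_r (i : 'I_n) (b : A) : A := b * f i - f i * wpi i * b * wp i.

Definition torus : seq ('I_n -> A) := [:: w; wi; wp; wpi].

Record relations : Prop := Relations {
  rel_torus : forall g h, List.In g torus -> List.In h torus ->
    forall i j, g i * h j = h j * g i;
  rel_w : forall i, w i * wi i = 1;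
  rel_wp : forall i, wp i * wpi i = 1;
  rel_we : forall i j, w j * e i * wi j = cst r s i j *: e i;
  rel_wf : forall i j, w j * f i * wi j = (cst r s i j)^-1 *: f i;
  rel_wpe : forall i j, wp j * e i * wpi j = (cst r s j i)^-1 *: e i;
  rel_wpf : forall i j, wp j * f i * wpi j = cst r s j i *: f i;
  rel_ef : forall i j, e i * f j - f j * e i =
    ((i == j)%:R / (rr r i - ss s i)) *: (w i - wp i);
  rel_serre_e : forall i j, i != j -> iter `|1 - cartan i j|%N (ad_l i) (e j) = 0;
  rel_serre_f : forall i j, i != j -> iter `|1 - cartan i j|%N (ad_r i) (f j) = 0
}.

End Relations.

(* The algebra U_{r,s}(so_{2n+1}): formal expressions in the generators, two of
   them being identified when they have the same value at all elements of all
   K-algebras that satisfy the defining relations.  Lemmas U_relations,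
   U_universal and U_generated show that it is the algebra presented by these
   generators and relations. *)
Section Algebra.
Variables (n : nat) (K : fieldType) (r s : K).

Inductive gen : Type :=
  GE of 'I_n | GF of 'I_n | GW of 'I_n | GWi of 'I_n | GWp of 'I_n | GWpi of 'I_n.

Inductive expr : Type :=
| Var of gen
| Cst of K
| Add of expr & expr
| Mul of expr & expr.

HB.instance Definition _ := gen_eqMixin expr.
HB.instance Definition _ := gen_choiceMixin expr.

Fixpoint eval (A : algType K) (v : gen -> A) (t : expr) : A :=
  match t with
  | Var g => v g
  | Cst c => c%:A
  | Add t1 t2 => eval v t1 + eval v t2
  | Mul t1 t2 => eval v t1 * eval v t2
  end.

Definition gen_relations (A : algType K) (v : gen -> A) : Prop :=
  relations r s (v \o GE) (v \o GF) (v \o GW) (v \o GWi) (v \o GWp) (v \o GWpi).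

Definition expr_rel (t t' : expr) : bool :=
  `[< forall (A : algType K) (v : gen -> A),
        gen_relations v -> eval v t = eval v t' >].

Lemma expr_relP t t' :
  reflect (forall (A : algType K) (v : gen -> A),
             gen_relations v -> eval v t = eval v t') (expr_rel t t').
Proof. exact: asboolP. Qed.

Lemma expr_rel_equiv : equiv_class_of expr_rel.
Proof.
split=> [t|t t'|t u v].
- by apply/expr_relP.
- by apply/expr_relP/expr_relP => H A v hv; rewrite H.
- by move=> /expr_relP H1 /expr_relP H2; apply/expr_relP => A x hx; rewrite H1 // H2.
Qed.

Canonical expr_equiv := EquivRelPack expr_rel_equiv.

Definition U := {eq_quot expr_equiv}.
HB.instance Definition _ := Choice.on U.
HB.instance Definition _ := EqQuotient.on U.

Lemma U_eqP t t' :
  reflect (forall (A : algType K) (v : gen -> A),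
             gen_relations v -> eval v t = eval v t') (\pi_U t == \pi_U t').
Proof. by apply: (iffP eqP) => [/eqmodP/expr_relP|H]; [|apply/eqmodP/expr_relP]. Qed.

Lemma U_reprE t (A : algType K) (v : gen -> A) : gen_relations v ->
  eval v (repr (\pi_U t)) = eval v t.
Proof. by apply/U_eqP; rewrite reprK. Qed.

Definition U_add (x y : U) : U := \pi_U (Add (repr x) (repr y)).
Definition U_opp (x : U) : U := \pi_U (Mul (Cst (-1)) (repr x)).
Definition U_mul (x y : U) : U := \pi_U (Mul (repr x) (repr y)).
Definition U_scale (c : K) (x : U) : U := \pi_U (Mul (Cst c) (repr x)).

Lemma U_addA : associative U_add.
Proof. by move=> x y z; apply/eqP/U_eqP => A v hv; rewrite /= !U_reprE //= addrA. Qed.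
Lemma U_addC : commutative U_add.
Proof. by move=> x y; apply/eqP/U_eqP => A v hv; rewrite /= addrC. Qed.
Lemma U_add0 : left_id (\pi_U (Cst 0)) U_add.
Proof.
move=> x; rewrite -[RHS]reprK; apply/eqP/U_eqP => A v hv.
by rewrite /= U_reprE //= scale0r add0r.
Qed.
Lemma U_addN : left_inverse (\pi_U (Cst 0)) U_opp U_add.
Proof.
move=> x; apply/eqP/U_eqP => A v hv.
by rewrite /= U_reprE //= scaleN1r mulN1r addNr scale0r.
Qed.

HB.instance Definition _ :=
  GRing.isZmodule.Build U U_addA U_addC U_add0 U_addN.

Lemma U_mulA : associative U_mul.
Proof. by move=> x y z; apply/eqP/U_eqP => A v hv; rewrite /= !U_reprE //= mulrA. Qed.
Lemma U_mul1l : left_id (\pi_U (Cst 1)) U_mul.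
Proof.
move=> x; rewrite -[RHS]reprK; apply/eqP/U_eqP => A v hv.
by rewrite /= U_reprE //= scale1r mul1r.
Qed.
Lemma U_mul1r : right_id (\pi_U (Cst 1)) U_mul.
Proof.
move=> x; rewrite -[RHS]reprK; apply/eqP/U_eqP => A v hv.
by rewrite /= U_reprE //= scale1r mulr1.
Qed.
Lemma U_mulDl : left_distributive U_mul U_add.
Proof. by move=> x y z; apply/eqP/U_eqP => A v hv; rewrite /= !U_reprE //= mulrDl. Qed.
Lemma U_mulDr : right_distributive U_mul U_add.
Proof. by move=> x y z; apply/eqP/U_eqP => A v hv; rewrite /= !U_reprE //= mulrDr. Qed.

Definition counit_val (g : gen) : K^o :=
  match g with GE _ | GF _ => 0 | _ => 1 end.

Lemma counit_relations : gen_relations counit_val.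
Proof.
split=> /= [g h _ _ i j|i|i|i j|i j|i j|i j|i j|i j _|i j _].
- exact: mulrC.
- exact: mulr1.
- exact: mulr1.
- by rewrite mulr0 mul0r scaler0.
- by rewrite mulr0 mul0r scaler0.
- by rewrite mulr0 mul0r scaler0.
- by rewrite mulr0 mul0r scaler0.
- by rewrite !mulr0 !subrr scaler0.
- by elim: `|_|%N => //= m ->; rewrite /ad_l !(mulr0, mul0r) subrr.
- by elim: `|_|%N => //= m ->; rewrite /ad_r !(mulr0, mul0r) subrr.
Qed.

Lemma U_one_neq0 : \pi_U (Cst 1) != \pi_U (Cst 0).
Proof.
apply/negP => /U_eqP/(_ _ _ counit_relations) /= /eqP.
by rewrite scale0r scale1r oner_eq0.
Qed.

HB.instance Definition _ := GRing.Zmodule_isNzRing.Build U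
  U_mulA U_mul1l U_mul1r U_mulDl U_mulDr U_one_neq0.

Lemma U_scaleA c c' x : U_scale c (U_scale c' x) = U_scale (c * c') x.
Proof.
apply/eqP/U_eqP => A v hv; rewrite /= U_reprE //=.
by rewrite mulrA -scalerAl mul1r scalerA.
Qed.
Lemma U_scale1 : left_id 1 U_scale.
Proof.
move=> x; rewrite -[RHS]reprK; apply/eqP/U_eqP => A v hv.
by rewrite /= scale1r mul1r.
Qed.
Lemma U_scaleDr : right_distributive U_scale +%R.
Proof.
by move=> c x y; apply/eqP/U_eqP => A v hv; rewrite /= !U_reprE //= mulrDr.
Qed.
Lemma U_scaleDl x : {morph U_scale^~ x : c c' / c + c'}.
Proof.
move=> c c'; apply/eqP/U_eqP => A v hv.
by rewrite /= !U_reprE //= scalerDl mulrDl.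
Qed.

HB.instance Definition _ := GRing.Zmodule_isLmodule.Build K U
  U_scaleA U_scale1 U_scaleDr U_scaleDl.

Lemma U_scaleAl (c : K) (x y : U) : c *: (x * y) = (c *: x) * y.
Proof. by apply/eqP/U_eqP => A v hv; rewrite /= !U_reprE //= mulrA. Qed.
HB.instance Definition _ := GRing.Lmodule_isLalgebra.Build K U U_scaleAl.

Lemma U_scaleAr (c : K) (x y : U) : c *: (x * y) = x * (c *: y).
Proof.
apply/eqP/U_eqP => A v hv; rewrite /= !U_reprE //=.
by rewrite -!scalerAl !mul1r scalerAr.
Qed.
HB.instance Definition _ := GRing.Lalgebra_isAlgebra.Build K U U_scaleAr.

Definition u_gen (g : gen) : U := \pi_U (Var g).
Definition ue i := u_gen (GE i).
Definition uf i := u_gen (GF i).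
Definition uw i := u_gen (GW i).
Definition uwi i := u_gen (GWi i).
Definition uwp i := u_gen (GWp i).
Definition uwpi i := u_gen (GWpi i).

Lemma eval_u_gen t : eval u_gen t = \pi_U t.
Proof.
elim: t => [g|c|t1 IH1 t2 IH2|t1 IH1 t2 IH2] //=; rewrite ?IH1 ?IH2;
  apply/eqP/U_eqP => A v hv; rewrite /= !U_reprE //=.
by rewrite scale1r mulr1.
Qed.

Lemma U_generated x : subalg (fun y => exists g, y = u_gen g) x.
Proof.
rewrite -[x]reprK -eval_u_gen.
elim: (repr x) => [g|c|t1 IH1 t2 IH2|t1 IH1 t2 IH2] /=.
- by apply: subalg_gen; exists g.
- exact: subalg_const.
- by rewrite -[eval _ t1]scale1r; apply: subalg_lin.
- exact: subalg_mul.
Qed.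

Section Morphism.
Variables (A : algType K) (v : gen -> A) (hv : gen_relations v).

Definition U_hom of gen_relations v := fun x : U => eval v (repr x).

Lemma U_hom_add : zmod_morphism (U_hom hv).
Proof.
move=> x y; rewrite /U_hom.
rewrite (U_reprE (Add (repr x) (repr (U_opp y))) hv) /= U_reprE //=.
by rewrite scaleN1r mulN1r.
Qed.
HB.instance Definition _ := GRing.isZmodMorphism.Build U A (U_hom hv) U_hom_add.

Lemma U_hom_mul : monoid_morphism (U_hom hv).
Proof.
split; first by rewrite /U_hom (U_reprE (Cst 1) hv) /= scale1r.
by move=> x y; apply: (U_reprE (Mul (repr x) (repr y)) hv).
Qed.
HB.instance Definition _ := GRing.isMonoidMorphism.Build U A (U_hom hv) U_hom_mul.

Lemma U_hom_scale : scalable (U_hom hv).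
Proof.
move=> c x; rewrite /U_hom (U_reprE (Mul (Cst c) (repr x)) hv) /=.
by rewrite -scalerAl mul1r.
Qed.
HB.instance Definition _ := GRing.isScalable.Build K U A _ (U_hom hv) U_hom_scale.

Lemma U_universal :
  exists phi : {lrmorphism U -> A}, forall g, phi (u_gen g) = v g.
Proof. by exists (U_hom hv) => g; apply: U_reprE. Qed.

End Morphism.

Lemma U_relations : gen_relations u_gen.
Proof.
have lift t t' : (forall (A : algType K) (v : gen -> A),
    gen_relations v -> eval v t = eval v t') -> eval u_gen t = eval u_gen t'.
  by move=> H; rewrite !eval_u_gen; apply/eqP/U_eqP.
have ad (A : algType K) (v : gen -> A) (i : 'I_n) m (t : expr) :
   iter m (ad_l (v \o GE) (v \o GW) (v \o GWi) i) (eval v t)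
   = eval v (iter m (fun b => Add (Mul (Var (GE i)) b)
       (Mul (Cst (-1)) (Mul (Mul (Mul (Var (GW i)) b) (Var (GWi i))) (Var (GE i))))) t).
  by elim: m => //= m ->; rewrite /ad_l /= scaleN1r mulN1r.
have ad' (A : algType K) (v : gen -> A) (i : 'I_n) m (t : expr) :
   iter m (ad_r (v \o GF) (v \o GWp) (v \o GWpi) i) (eval v t)
   = eval v (iter m (fun b => Add (Mul b (Var (GF i)))
       (Mul (Cst (-1)) (Mul (Mul (Mul (Var (GF i)) (Var (GWpi i))) b) (Var (GWp i))))) t).
  by elim: m => //= m ->; rewrite /ad_r /= scaleN1r mulN1r.
have cstE (A : algType K) (v : gen -> A) c t :
  c *: eval v t = eval v (Mul (Cst c) t).
  by rewrite /= -scalerAl mul1r.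
have subE (A : algType K) (v : gen -> A) t t' :
  eval v t - eval v t' = eval v (Add t (Mul (Cst (-1)) t')).
  by rewrite /= scaleN1r mulN1r.
have zE (A : algType K) (v : gen -> A) : 0 = eval v (Cst 0).
  by rewrite /= scale0r.
split.
- have torusP (g : 'I_n -> U) :
    List.In g (torus (u_gen \o GW) (u_gen \o GWi) (u_gen \o GWp) (u_gen \o GWpi)) ->
    exists k : 'I_n -> gen, g = u_gen \o k /\ forall (A : algType K) (v : gen -> A),
      List.In (v \o k) (torus (v \o GW) (v \o GWi) (v \o GWp) (v \o GWpi)).
    move=> /= [<-|[<-|[<-|[<-|[]]]]];
     [exists GW|exists GWi|exists GWp|exists GWpi]; split=> // A v; tauto.
  move=> g h /torusP[k [-> hk]] /torusP[l [-> hl]] i j.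
  apply: (lift (Mul (Var (k i)) (Var (l j))) (Mul (Var (l j)) (Var (k i)))).
  by move=> A v hv; apply: (rel_torus hv (hk A v) (hl A v)).
- move=> i; rewrite -[RHS]scale1r.
  apply: (lift (Mul (Var (GW i)) (Var (GWi i))) (Cst 1)) => A v hv /=.
  by rewrite scale1r; apply: (rel_w hv).
- move=> i; rewrite -[RHS]scale1r.
  apply: (lift (Mul (Var (GWp i)) (Var (GWpi i))) (Cst 1)) => A v hv /=.
  by rewrite scale1r; apply: (rel_wp hv).
- move=> i j; rewrite (cstE _ u_gen _ (Var (GE i))).
  apply: (lift (Mul (Mul (Var (GW j)) (Var (GE i))) (Var (GWi j)))) => A v hv.
  by rewrite -cstE; apply: (rel_we hv).
- move=> i j; rewrite (cstE _ u_gen _ (Var (GF i))).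
  apply: (lift (Mul (Mul (Var (GW j)) (Var (GF i))) (Var (GWi j)))) => A v hv.
  by rewrite -cstE; apply: (rel_wf hv).
- move=> i j; rewrite (cstE _ u_gen _ (Var (GE i))).
  apply: (lift (Mul (Mul (Var (GWp j)) (Var (GE i))) (Var (GWpi j)))) => A v hv.
  by rewrite -cstE; apply: (rel_wpe hv).
- move=> i j; rewrite (cstE _ u_gen _ (Var (GF i))).
  apply: (lift (Mul (Mul (Var (GWp j)) (Var (GF i))) (Var (GWpi j)))) => A v hv.
  by rewrite -cstE; apply: (rel_wpf hv).
- move=> i j.
  rewrite (subE _ u_gen (Mul (Var (GE i)) (Var (GF j))) (Mul (Var (GF j)) (Var (GE i)))).
  rewrite (subE _ u_gen (Var (GW i)) (Var (GWp i))) cstE.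
  by apply: lift => A v hv; rewrite -cstE -!subE; apply: (rel_ef hv).
- move=> i j hij; rewrite (ad _ u_gen i _ (Var (GE j))) (zE _ u_gen); apply: lift => A v hv.
  by rewrite -zE -ad; apply: (rel_serre_e hv).
- move=> i j hij; rewrite (ad' _ u_gen i _ (Var (GF j))) (zE _ u_gen); apply: lift => A v hv.
  by rewrite -zE -ad'; apply: (rel_serre_f hv).
Qed.

End Algebra.

Section QuantumGroup.
Variables (n : nat) (K : fieldType) (r s : K).
Local Notation U := (U n r s).
Local Notation e := (@ue n K r s).
Local Notation f := (@uf n K r s).
Local Notation w := (@uw n K r s).
Local Notation wi := (@uwi n K r s).
Local Notation wp := (@uwp n K r s).
Local Notation wpi := (@uwpi n K r s).

Record coproduct (Delta : {rmorphism U -> tens U U}) : Prop := Coproduct {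
  coproduct_scale : scalable Delta;
  coproduct_e : forall i, Delta (e i) = e i ⊗ 1 + w i ⊗ e i;
  coproduct_f : forall i, Delta (f i) = 1 ⊗ f i + f i ⊗ wp i;
  coproduct_w : forall i, Delta (w i) = w i ⊗ w i;
  coproduct_wp : forall i, Delta (wp i) = wp i ⊗ wp i
}.

(* The subalgebras generated by the e_i, omega_i^{+-1}, resp. by the f_i,
   (omega'_i)^{+-1}. *)
Definition borel_e : U -> Prop :=
  subalg (fun x => exists i, [\/ x = e i, x = w i | x = wi i]).
Definition borel_f : U -> Prop :=
  subalg (fun x => exists i, [\/ x = f i, x = wp i | x = wpi i]).

(* phi y x is < y, x >; only its values for y in borel_f and x in borel_e
   matter.  In the last two axioms the coproduct is expanded as a sum of pure
   tensors with factors in the relevant Hopf subalgebra. *)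
Record skew_pairing (Delta : U -> tens U U) (phi : U -> U -> K) : Prop :=
  SkewPairing {
  skew_linl : forall c y y' x, borel_f y -> borel_f y' -> borel_e x ->
    phi (c *: y + y') x = c * phi y x + phi y' x;
  skew_linr : forall c y x x', borel_f y -> borel_e x -> borel_e x' ->
    phi y (c *: x + x') = c * phi y x + phi y x';
  skew_fe : forall i j, phi (f i) (e j) = (i == j)%:R / (ss s i - rr r i);
  skew_ww : forall i j, phi (wp i) (w j) = cst r s i j;
  skew_fw : forall i j, phi (f i) (w j) = 0;
  skew_we : forall i j, phi (wp i) (e j) = 0;
  skew_mulr : forall y x x' (m : nat) (a b : 'I_m -> U),
    borel_f y -> borel_e x -> borel_e x' ->
    (forall k, borel_f (a k)) -> (forall k, borel_f (b k)) ->
    Delta y = \sum_k a k ⊗ b k ->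
    phi y (x * x') = \sum_k phi (b k) x * phi (a k) x';
  skew_mull : forall y y' x (m : nat) (a b : 'I_m -> U),
    borel_f y -> borel_f y' -> borel_e x ->
    (forall k, borel_e (a k)) -> (forall k, borel_e (b k)) ->
    Delta x = \sum_k a k ⊗ b k ->
    phi (y * y') x = \sum_k phi y (a k) * phi y' (b k)
}.

(* z stands for sum_i z_i alpha_i. *)
Definition monomial (g : 'I_n -> U) (z : {ffun 'I_n -> nat}) (x : U) : Prop :=
  exists2 l : seq 'I_n, forall i, count_mem i l = z i & x = \prod_(i <- l) g i.

(* e_{i_1} ... e_{i_m} has weight alpha_{i_1} + ... + alpha_{i_m}, and
   f_{i_1} ... f_{i_m} the opposite weight. *)
Definition U_plus z : U -> Prop := span (monomial e z).
Definition U_minus z : U -> Prop := span (monomial f z).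

End QuantumGroup.

(* The vector representation.  Vectors of V are columns, and positions are
   numbered from 1 to 2n+1. *)
Section VectorRepresentation.
Variables (n : nat) (K : fieldType) (r s : K).
Local Notation N := n.*2.+1.

(* i' *)
Definition pr (i : nat) : nat := n.*2.+2 - i.

Definition E (i j : nat) : 'M[K]_N := delta_mx (inord i.-1) (inord j.-1).

Definition omega_mx (x y : K) (i : nat) : 'M[K]_N :=
  x ^+ 2 *: E i i + y ^+ 2 *: E i.+1 i.+1
  + y ^- 2 *: E (pr i.+1) (pr i.+1) + x ^- 2 *: E (pr i) (pr i)
  + \sum_(1 <= j < n.*2.+2 | j \notin [:: i; i.+1; pr i; pr i.+1]) E j j.

Definition omega_n_mx (x y : K) : 'M[K]_N :=
  (x / y) *: E n n + E n.+1 n.+1 + (x^-1 * y) *: E (pr n) (pr n)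
  + (x * y)^-1 *: (\sum_(1 <= j < n) E j j)
  + (x * y) *: (\sum_(pr n.-1 <= j < n.*2.+2) E j j).

(* sqr, sqs, sqrs are the chosen square roots of r, s, r + s. *)
Record vector_rep (sqr sqs sqrs : K) (rho : {lrmorphism U n r s -> 'M[K]_N}) :
    Prop := VectorRep {
  vec_e : forall i : 'I_n, (i.+1 < n)%N ->
    rho (ue r s i) = E i.+1 i.+2 - (r * s)^-1 *: E (pr i.+2) (pr i.+1);
  vec_f : forall i : 'I_n, (i.+1 < n)%N ->
    rho (uf r s i) = E i.+2 i.+1 - (r * s)^-1 *: E (pr i.+1) (pr i.+2);
  vec_w : forall i : 'I_n, (i.+1 < n)%N -> rho (uw r s i) = omega_mx r s i.+1;
  vec_wp : forall i : 'I_n, (i.+1 < n)%N -> rho (uwp r s i) = omega_mx s r i.+1;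
  vec_en : forall i : 'I_n, i.+1 = n ->
    rho (ue r s i) =
      sqrs *: ((sqr * sqs)^-1 *: E n n.+1 - r^-1 *: E n.+1 (pr n));
  vec_fn : forall i : 'I_n, i.+1 = n ->
    rho (uf r s i) =
      sqrs *: ((sqr * sqs)^-1 *: E n.+1 n - s^-1 *: E (pr n) n.+1);
  vec_wn : forall i : 'I_n, i.+1 = n -> rho (uw r s i) = omega_n_mx r s;
  vec_wpn : forall i : 'I_n, i.+1 = n -> rho (uwp r s i) = omega_n_mx s r
}.

(* Coordinates on the simple roots of epsilon_i = alpha_i + ... + alpha_n, and
   of the weight of v_i. *)
Definition eps (i : nat) : 'I_n -> int := fun j => (i <= j.+1)%N%:Z.
Definition wt (i : nat) : 'I_n -> int :=
  if (i <= n)%N then eps i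
  else if i == n.+1 then fun=> 0
  else fun j => - eps (pr i) j.

(* Operators on V ⊗ V are Kronecker products of matrices. *)
Definition flip : 'M[K]_(N * N) :=
  \sum_(1 <= i < n.*2.+2) \sum_(1 <= j < n.*2.+2) E j i *t E i j.

Definition ftilde : 'M[K]_(N * N) :=
  \sum_(1 <= i < n.*2.+2) \sum_(1 <= j < n.*2.+2)
    (cst_lattice r s (wt j) (wt i))^-1 *: (E i i *t E j j).

Lemma sum_position (W : nmodType) (F : nat -> W) :
  \sum_(1 <= i < n.*2.+2) F i = \sum_(i < N) F i.+1.
Proof. by rewrite big_add1 big_mkord. Qed.

Lemma E_ord (i j : 'I_N) : E i.+1 j.+1 = delta_mx i j.
Proof. by rewrite /E /= !inord_val. Qed.

Lemma mul_deltaE (i j a : 'I_N) (x : 'cV[K]_N) (k : 'I_1) :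
  (delta_mx i j *m x) a k = (a == i)%:R * x j k.
Proof.
rewrite mxE (bigD1 j) //= big1 ?addr0 => [|l lj]; first by rewrite mxE eqxx andbT.
by rewrite mxE (negbTE lj) andbF mul0r.
Qed.

Lemma flipE (x y : 'cV[K]_N) : flip *m (x *t y) = y *t x.
Proof.
apply/matrixP => p c.
case: (mxtens_indexP p) => a b; case: (@mxtens_indexP 1 1 c) => k l.
rewrite /flip sum_position mulmx_suml summxE tensmxE.
under eq_bigr => i _ do rewrite sum_position mulmx_suml summxE.
rewrite (bigD1 b) //= [X in _ + X]big1 ?addr0 => [|i ib].
  rewrite (bigD1 a) //= big1 ?addr0 => [|j ja];
    rewrite !E_ord tensmx_mul tensmxE !mul_deltaE ?eqxx ?mul1r 1?mulrC.
    by rewrite (ord1 k) (ord1 l).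
  by rewrite [a == j]eq_sym (negbTE ja) mul0r mulr0.
apply: big1 => j _; rewrite !E_ord tensmx_mul tensmxE !mul_deltaE.
by rewrite [b == i]eq_sym (negbTE ib) mul0r mulr0.
Qed.

Lemma ftildeE (i j : 'I_N) (v := fun k : 'I_N => delta_mx k 0 : 'cV[K]_N) :
  ftilde *m (v i *t v j) =
  (cst_lattice r s (wt j.+1) (wt i.+1))^-1 *: (v i *t v j).
Proof.
rewrite /ftilde sum_position mulmx_suml.
under eq_bigr => k _ do rewrite sum_position mulmx_suml.
rewrite (bigD1 i) //= [X in _ + X]big1 ?addr0 => [|k ki].
  rewrite (bigD1 j) //= big1 ?addr0 => [|l lj]; rewrite -scalemxAl !E_ord tensmx_mul.
    by rewrite /v !mul_delta_mx.
  by rewrite (mul_delta_mx_0 _ _ _ lj) tensmx0 scaler0.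
apply: big1 => l _; rewrite -scalemxAl !E_ord tensmx_mul.
by rewrite (mul_delta_mx_0 _ _ _ ki) tens0mx scaler0.
Qed.

(* The action of Theta on V ⊗ V, given bases u z of U_plus z and v z of
   U_minus z.  A finitely supported sum over z (0 if the support is infinite). *)
Definition Theta_VV (rho : U n r s -> 'M[K]_N) (d : {ffun 'I_n -> nat} -> nat)
    (u v : forall z, 'I_(d z) -> U n r s) : 'M[K]_(N * N) :=
  \sum_(z \in [set: {ffun 'I_n -> nat}]%classic)
    \sum_k (rho (v z k) *t rho (u z k)).

Definition R_VV rho d u v : 'M[K]_(N * N) :=
  @Theta_VV rho d u v *m ftilde *m flip.

Definition setA (i j : nat) : bool :=
  [&& 1 <= i <= n & i.+1 <= j <= n]%N
  || [&& 2 <= i <= n & pr i.-1 <= j <= pr 1]%N.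
Definition setB (i j : nat) : bool :=
  [&& 1 <= i <= n.-1 & pr n <= j <= pr i.+1]%N
  || [&& pr n <= i <= pr 2 & i.+1 <= j <= pr 1]%N.

(* Twice rho_i: the power (r^-1 s)^(rho_i - rho_j) is
   (sqr^-1 sqs)^(rho2 i - rho2 j). *)
Definition rho2 (i : nat) : int :=
  if (i < n.+1)%N then n.*2.+1%:Z - i.*2%:Z
  else if i == n.+1 then 0
  else - (n.*2.+1%:Z - (pr i).*2%:Z).

End VectorRepresentation.

Arguments E {n K} i j.

(* Main.v *)
(* Both R and the closed form commute with the operators
   F_i = 1 (x) f_i + f_i (x) omega'_i.  For R this is the intertwining property
   of Theta, which follows from the expression of [f_i, x], x in U^+, through the
   skew derivations dual to multiplication by f_i, combined with the
   compatibility of f~ P with weights.  For the closed form it is a scalar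
   identity, because the sum of the (s/r)^rho_c v_c (x) v_(c') telescopes under
   F_i.  Both operators agree on the vectors v_1 (x) v_b, since Theta fixes
   v_b (x) v_1, where v_1 is killed by every e_i.  As F_i (v_a (x) v_b) is the sum
   of multiples of v_a (x) v_(b+1) and v_(a+1) (x) v_b, with the second coefficient
   nonzero for some i, they agree everywhere by induction on a. *)
Require Import Defs.
From HB Require Import structures.
From mathcomp Require Import all_boot all_order all_algebra.
From mathcomp Require Import classical_sets fsbigop.
From mathcomp.real_closed Require Import mxtens.
From mathcomp Require Import zify ring.

Set Implicit Arguments.
Unset Strict Implicit.
Unset Printing Implicit Defensive.

Import GRing.Theory.
Local Open Scope ring_scope.

(** No basis of [U_plus] is ever computed and Theta is never written out: the dual bases enter only
    through the expansions x = sum phi(v_k, x) u_k and y = sum phi(y, u_k) v_k, which turn a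
    statement about Theta into one about adjoints of multiplication by f_i. The obstacle is to
    obtain these adjoints. The pairing is constrained only on the two Borel subalgebras, through
    expansions of Delta into pure tensors from them, and words in the e_i satisfy Serre relations,
    so a recursive definition on words would need a proof of compatibility. The adjoints are
    therefore produced as existential witnesses along words, each together with an explicit
    expansion of the coproduct and its relevant contractions. The operators F_i alone suffice
    because the starting vectors v_1 ⊗ v_b already fill a whole row: each v_(a+1) ⊗ v_b is reached
    from row a by a single F_i. *)

Local Notation span := Defs.span.

(** * Spans, generated subalgebras, nonvanishing of structure constants *)

Section Span.
Variables (K : fieldType) (W : lmodType K).
Implicit Types S T : W -> Prop.

Lemma span_incl S x : S x -> span S x.
Proof. by move=> Sx; rewrite -[x]scale1r -[_ *: _]addr0; apply: span_lin => //; apply: span_zero. Qed.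

Lemma span_add S x y : span S x -> span S y -> span S (x + y).
Proof.
elim=> [|c u v Su _ IH] Sy; first by rewrite add0r.
by rewrite -addrA; apply: span_lin => //; apply: IH.
Qed.

Lemma span_scale S c x : span S x -> span S (c *: x).
Proof.
elim=> [|d u v Su _ IH]; first by rewrite scaler0; apply: span_zero.
by rewrite scalerDr scalerA; apply: span_lin.
Qed.

Lemma span_empty S x : (forall y, ~ S y) -> span S x -> x = 0.
Proof. by move=> S0; case=> // c u v /S0. Qed.

End Span.

Lemma span_linear (K : fieldType) (W W' : lmodType K) (g : W -> W')
    (S : W -> Prop) (T : W' -> Prop) x :
  linear g -> (forall y, S y -> span T (g y)) -> span S x -> span T (g x).
Proof.
move=> gL ST; elim=> [|c u v Su _ IH].
  by rewrite -[0](addNr 0) -scaleN1r gL scaleN1r addNr; apply: span_zero.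
by rewrite gL; apply: span_add => //; apply/span_scale/ST.
Qed.

Lemma span_mono (K : fieldType) (W : lmodType K) (S T : W -> Prop) x :
  (forall y, S y -> T y) -> span S x -> span T x.
Proof. by move=> ST; apply: (@span_linear _ _ _ idfun) => // y /ST; apply: span_incl. Qed.

Lemma subalg_scale (K : fieldType) (A : algType K) (S : A -> Prop) c x :
  subalg S x -> subalg S (c *: x).
Proof. by move=> Sx; rewrite -[x]mul1r scalerAl; apply: subalg_mul => //; apply: subalg_const. Qed.

Lemma subalg_closed_span (K : fieldType) (A : algType K) (S T : A -> Prop) x :
  (forall y, T y -> subalg S y) -> span T x -> subalg S x.
Proof.
move=> TS; elim=> [|c u v Tu _ IH]; last by apply: subalg_lin => //; apply: TS.
by rewrite -[0](scale0r 1); apply: subalg_const.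
Qed.

Lemma subalg_prod (K : fieldType) (A : algType K) (S : A -> Prop) I (g : I -> A) l :
  (forall i, subalg S (g i)) -> subalg S (\prod_(i <- l) g i).
Proof.
move=> Sg; elim: l => [|i l IH]; first by rewrite big_nil; apply: subalg_one.
by rewrite big_cons; apply: subalg_mul.
Qed.

Lemma prod_rcons (R : pzSemiRingType) I (l : seq I) j (g : I -> R) :
  \prod_(i <- rcons l j) g i = (\prod_(i <- l) g i) * g j.
Proof. by rewrite -cats1 big_cat big_seq1. Qed.

Section Constants.
Variables (n : nat) (K : fieldType) (r s : K).
Hypotheses (r0 : r != 0) (s0 : s != 0).

Lemma cst_neq0 (i j : 'I_n) : cst r s i j != 0.
Proof.
rewrite /cst; case: ifP => _; first by case: ifP => _; rewrite mulf_neq0 ?invr_eq0 ?expf_neq0.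
case: ifP => _; first by rewrite invr_eq0 expf_neq0.
by case: ifP => _; rewrite ?oner_neq0 ?expf_neq0.
Qed.

Lemma rr_sub_ss_neq0 (i : 'I_n) : r - s != 0 -> r + s != 0 -> rr r i - ss s i != 0.
Proof. by rewrite /rr /ss => h1 h2; case: ifP => // _; rewrite subr_sqr mulf_neq0. Qed.

End Constants.

(** * The skew pairing and the skew derivations dual to multiplication by f_i *)

Section Pairing.
Variables (n : nat) (K : fieldType) (r s : K).
Hypotheses (r0 : r != 0) (s0 : s != 0) (rms : r - s != 0) (rps : r + s != 0).
Hypothesis n0 : (0 < n)%N.
Variables (Delta : {rmorphism U n r s -> tens (U n r s) (U n r s)}).
Hypothesis hDelta : coproduct Delta.
Variables (phi : U n r s -> U n r s -> K).
Hypothesis hphi : skew_pairing Delta phi.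

Local Notation U := (U n r s).
Local Notation e := (@ue n K r s).
Local Notation f := (@uf n K r s).
Local Notation w := (@uw n K r s).
Local Notation wi := (@uwi n K r s).
Local Notation wp := (@uwp n K r s).
Local Notation wpi := (@uwpi n K r s).
Local Notation be := (@borel_e n K r s).
Local Notation bf := (@borel_f n K r s).
Local Notation q i := ((ss s i - rr r i)^-1).

Let Ur : gen_relations r s (u_gen r s) := @U_relations n K r s.

Lemma be_e i : be (e i).
Proof. by apply: subalg_gen; exists i; apply: Or31. Qed.
Lemma be_w i : be (w i).
Proof. by apply: subalg_gen; exists i; apply: Or32. Qed.
Lemma bf_f i : bf (f i).
Proof. by apply: subalg_gen; exists i; apply: Or31. Qed.
Lemma bf_wp i : bf (wp i).
Proof. by apply: subalg_gen; exists i; apply: Or32. Qed.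
Lemma be1 : be 1. Proof. exact: subalg_one. Qed.
Lemma bf1 : bf 1. Proof. exact: subalg_one. Qed.
Lemma be_mul x y : be x -> be y -> be (x * y). Proof. exact: subalg_mul. Qed.
Lemma bf_mul x y : bf x -> bf y -> bf (x * y). Proof. exact: subalg_mul. Qed.
Lemma be_prod l : be (\prod_(i <- l) e i). Proof. exact: (subalg_prod _ be_e). Qed.
Lemma bf_prod l : bf (\prod_(i <- l) f i). Proof. exact: (subalg_prod _ bf_f). Qed.
Hint Resolve be_mul bf_mul be_prod bf_prod be_e be_w bf_f bf_wp be1 bf1 : core.

Lemma w_e i j : w j * e i = cst r s i j *: (e i * w j).
Proof.
have h : wi j * w j = 1 by rewrite -(rel_w Ur j); apply: (rel_torus Ur) => /=; tauto.
by rewrite scalerAl -(rel_we Ur i j) -!mulrA [X in _ * (_ * X)]h mulr1.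
Qed.

Lemma e_wp i j : e i * wp j = cst r s j i *: (wp j * e i).
Proof.
have h : wpi j * wp j = 1 by rewrite -(rel_wp Ur j); apply: (rel_torus Ur) => /=; tauto.
have := congr1 (fun x => x * wp j) (rel_wpe Ur i j).
rewrite -!mulrA [X in _ * (_ * X)]h mulr1 -scalerAl => ->.
by rewrite scalerA mulfV ?scale1r // cst_neq0.
Qed.

Lemma f_e i j : f i * e j - e j * f i = ((i == j)%:R * q i) *: (w i - wp i).
Proof.
rewrite -opprB [e j * _ - _](rel_ef Ur) -scaleNr; case: (eqVneq i j) => [->|ij].
  by rewrite !mul1r -invrN opprB.
by rewrite !mul0r oppr0 !scale0r.
Qed.

Lemma phi_0l x : be x -> phi 0 x = 0.
Proof.
move=> bx; have b0 : bf 0 by rewrite -[0](scale0r 1); apply: subalg_const.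
have := skew_linl hphi 1 b0 b0 bx.
by rewrite scaler0 addr0 mul1r -{1}[phi 0 x]addr0 => /addrI.
Qed.

Lemma phi_0r y : bf y -> phi y 0 = 0.
Proof.
move=> by_; have b0 : be 0 by rewrite -[0](scale0r 1); apply: subalg_const.
have := skew_linr hphi 1 by_ b0 b0.
by rewrite scaler0 addr0 mul1r -{1}[phi y 0]addr0 => /addrI.
Qed.

Lemma phi_sumr y m (c : 'I_m -> K) (x : 'I_m -> U) : bf y -> (forall k, be (x k)) ->
  phi y (\sum_k c k *: x k) = \sum_k c k * phi y (x k).
Proof.
move=> by_ bx.
suff [] : phi y (\sum_k c k *: x k) = \sum_k c k * phi y (x k) /\
  be (\sum_k c k *: x k) by [].
elim/big_ind2: _ => [|a1 x1 a2 x2 [h1 b1] [h2 b2]|k _].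
- by rewrite phi_0r //; split=> //; rewrite -[0](scale0r 1); apply: subalg_const.
- rewrite -{1 2}[x1]scale1r (skew_linr hphi) // mul1r h1 h2; split=> //.
  exact: subalg_lin.
- have b0 : be 0 by rewrite -[0](scale0r 1); apply: subalg_const.
  rewrite -[_ *: _]addr0 (skew_linr hphi) // phi_0r // !addr0; split=> //.
  exact: (subalg_scale _ (bx k)).
Qed.

Lemma phi_suml x m (c : 'I_m -> K) (y : 'I_m -> U) : be x -> (forall k, bf (y k)) ->
  phi (\sum_k c k *: y k) x = \sum_k c k * phi (y k) x.
Proof.
move=> bx by_.
suff [] : phi (\sum_k c k *: y k) x = \sum_k c k * phi (y k) x /\
  bf (\sum_k c k *: y k) by [].
elim/big_ind2: _ => [|a1 x1 a2 x2 [h1 b1] [h2 b2]|k _].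
- by rewrite phi_0l //; split=> //; rewrite -[0](scale0r 1); apply: subalg_const.
- rewrite -{1 2}[x1]scale1r (skew_linl hphi) // mul1r h1 h2; split=> //.
  exact: subalg_lin.
- have b0 : bf 0 by rewrite -[0](scale0r 1); apply: subalg_const.
  rewrite -[_ *: _]addr0 (skew_linl hphi) // phi_0l // !addr0; split=> //.
  exact: (subalg_scale _ (by_ k)).
Qed.

Lemma phi_f_mul i x x' : be x -> be x' ->
  phi (f i) (x * x') = phi (f i) x * phi 1 x' + phi (wp i) x * phi (f i) x'.
Proof.
move=> bx bx'.
pose a (k : 'I_2) := if k == ord0 then 1 else f i.
pose b (k : 'I_2) := if k == ord0 then f i else wp i.
rewrite (skew_mulr hphi (m := 2) (a := a) (b := b)) //.
- by rewrite 2!big_ord_recl big_ord0 addr0 /a /b /=.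
- by move=> k; rewrite /a; case: ifP.
- by move=> k; rewrite /b; case: ifP.
- by rewrite (coproduct_f hDelta) 2!big_ord_recl big_ord0 addr0 /a /b /=.
Qed.

Lemma phi_wp_mul i x x' : be x -> be x' ->
  phi (wp i) (x * x') = phi (wp i) x * phi (wp i) x'.
Proof.
move=> bx bx'.
rewrite (skew_mulr hphi (m := 1) (a := fun=> wp i) (b := fun=> wp i)) ?big_ord1 //.
exact: (coproduct_wp hDelta).
Qed.

Lemma phi_mul_w i y y' : bf y -> bf y' ->
  phi (y * y') (w i) = phi y (w i) * phi y' (w i).
Proof.
move=> h h'.
rewrite (skew_mull hphi (m := 1) (a := fun=> w i) (b := fun=> w i)) ?big_ord1 //.
exact: (coproduct_w hDelta).
Qed.

Lemma phi_mul_e i y y' : bf y -> bf y' ->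
  phi (y * y') (e i) = phi y (e i) * phi y' 1 + phi y (w i) * phi y' (e i).
Proof.
move=> h h'.
pose a (k : 'I_2) := if k == ord0 then e i else w i.
pose b (k : 'I_2) := if k == ord0 then 1 else e i.
rewrite (skew_mull hphi (m := 2) (a := a) (b := b)) //.
- by rewrite 2!big_ord_recl big_ord0 addr0 /a /b /=.
- by move=> k; rewrite /a; case: ifP.
- by move=> k; rewrite /b; case: ifP.
- by rewrite (coproduct_e hDelta) 2!big_ord_recl big_ord0 addr0 /a /b /=.
Qed.

Lemma q_neq0 (i : 'I_n) : q i != 0.
Proof. by rewrite invr_eq0 -oppr_eq0 opprB rr_sub_ss_neq0. Qed.

Lemma phi_f_e i j : phi (f i) (e j) = (i == j)%:R * q i.
Proof. exact: (skew_fe hphi). Qed.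

(** The pairing record prescribes no values at 1. Here and in the next four lemmas the counit values
    are recovered by expanding a product with a factor 1 and cancelling a known nonzero value. *)
Lemma phi_1_w i : phi 1 (w i) = 1.
Proof.
have := phi_mul_w i (bf_wp i) bf1; rewrite mulr1 (skew_ww hphi) -{1}[cst _ _ _ _]mulr1.
by move/(mulfI (cst_neq0 r0 s0 i i)).
Qed.

Lemma phi_1_1 : phi 1 1 = 1.
Proof.
have := phi_mul_e (Ordinal n0) (bf_f (Ordinal n0)) bf1.
rewrite mulr1 (skew_fw hphi) mul0r addr0 phi_f_e eqxx mul1r -{1}[_^-1]mulr1.
by move/(mulfI (q_neq0 _)).
Qed.

Lemma phi_1_e i : phi 1 (e i) = 0.
Proof.
have := phi_mul_e i (bf_wp i) bf1.
rewrite mulr1 (skew_we hphi) mul0r add0r (skew_ww hphi) => /esym/eqP.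
by rewrite mulf_eq0 (negbTE (cst_neq0 r0 s0 i i)) => /eqP.
Qed.

Lemma phi_wp_1 i : phi (wp i) 1 = 1.
Proof.
have := phi_f_mul i be1 (be_e i).
rewrite mul1r phi_1_e mulr0 add0r phi_f_e eqxx mul1r -{1}[_^-1]mul1r.
by move/(mulIf (q_neq0 _)).
Qed.

Lemma phi_f_1 i : phi (f i) 1 = 0.
Proof.
by have := phi_f_mul i be1 (be_w i); rewrite mul1r (skew_fw hphi) mulr0 addr0 phi_1_w mulr1.
Qed.

(** Concatenation of two families: multiplying an m-term coproduct by the two-term coproduct of a
    generator yields m + m pure tensors. *)
Let dbl (T : Type) m (a b : 'I_m -> T) (k : 'I_(m + m)) : T :=
  match split k with inl k => a k | inr k => b k end.

Let sum_dbl (V : nmodType) T T' m (a b : 'I_m -> T) (a' b' : 'I_m -> T') (g : T -> T' -> V) :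
  \sum_k g (dbl a b k) (dbl a' b' k) = \sum_k g (a k) (a' k) + \sum_k g (b k) (b' k).
Proof.
rewrite big_split_ord /=; congr (_ + _); apply: eq_bigr => k _; rewrite /dbl.
- by rewrite (unsplitK (inl k)).
- by rewrite (unsplitK (inr k)).
Qed.

Let dbl_P (T : Type) (P : T -> Prop) m (a b : 'I_m -> T) k :
  (forall k, P (a k)) -> (forall k, P (b k)) -> P (dbl a b k).
Proof. by rewrite /dbl; case: (split k). Qed.

(* The Sweedler components of a monomial x that matter are recorded by
   contraction with f_i and omega'_i: p and p' are the two skew derivations
   of x attached to f_i. *)
Lemma skew_derivation_word i (l : seq 'I_n) (x := \prod_(j <- l) e j)
    (S := span (fun y => exists2 m, perm_eq (i :: m) l & y = \prod_(j <- m) e j)) :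
  exists p p' : U, exists (m : nat) (a b : 'I_m -> U),
  [/\ S p /\ S p', f i * x - x * f i = p * w i - wp i * p',
     [/\ forall k, be (a k), forall k, be (b k) & Delta x = \sum_k a k ⊗ b k],
     \sum_k phi (f i) (b k) *: a k = p * w i /\
     \sum_k phi (wp i) (b k) *: a k = x &
     \sum_k phi (f i) (a k) *: b k = p' /\
     \sum_k phi (wp i) (a k) *: b k = (\prod_(j <- l) cst r s i j) *: x].
Proof.
have SD l' j (S1 := fun y => exists2 m, perm_eq (i :: m) l' & y = \prod_(j <- m) e j)
    (S2 := fun y => exists2 m, perm_eq (i :: m) (rcons l' j) & y = \prod_(j <- m) e j) y :
    span S1 y -> span S2 (y * e j).
  apply: (@span_linear _ _ _ (fun y : U => y * e j)) => [c u v|_ [m pm ->]].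
    by rewrite mulrDl scalerAl.
  apply: span_incl.
  by exists (rcons m j); rewrite ?prod_rcons // -rcons_cons -!cats1 perm_cat2r.
have SI l' j c (S2 := fun y => exists2 m, perm_eq (i :: m) (rcons l' j) & y = \prod_(j <- m) e j) :
    span S2 (((i == j)%:R * c) *: \prod_(k <- l') e k).
  rewrite {}/S2; case: (altP (i =P j)) => [<-|_]; last by rewrite mul0r scale0r; apply: span_zero.
  by apply/span_scale/span_incl; exists l' => //; rewrite perm_sym perm_rcons.
rewrite {}/S {}/x; elim/last_ind: l => [|l j].
  exists 0, 0, 1, (fun=> 1), (fun=> 1); split; rewrite ?big_nil ?big_ord1 //.
  - by split; apply: span_zero.
  - by rewrite mulr1 mul1r subrr mul0r mulr0 subr0.
  - by split=> //; rewrite rmorph1 //.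
  - by rewrite phi_f_1 phi_wp_1 scale0r scale1r mul0r.
  - by rewrite phi_f_1 phi_wp_1 scale0r scale1r.
case=> p [p' [m [a [b]]]]; rewrite !prod_rcons.
set x := \prod_(k <- l) e k; set C := \prod_(k <- l) cst r s i k.
case=> [[Sp Sp'] comm [ba bb Dx] [bf_p bw_x] [af_p aw_x]].
(* The commutator formula wants omega'_i on the left, while x [f_i, e_j] produces it on the right of
   x. *)
have xwp : x * wp i = C *: (wp i * x).
  rewrite /x /C; elim: (l) => [|k l' IH]; first by rewrite !big_nil scale1r mul1r mulr1.
  rewrite !big_cons -mulrA IH -scalerAr [e k * (wp i * _)]mulrA e_wp -scalerAl scalerA mulrA.
  by rewrite [cst _ _ _ _ * _]mulrC.
(* Both witnesses are read off from [f_i, x e_j] = [f_i, x] e_j + x [f_i, e_j], after moving omega_i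
   to the far right and omega'_i to the far left. *)
exists (cst r s j i *: (p * e j) + ((i == j)%:R * q i) *: x).
exists (p' * e j + ((i == j)%:R * (q i * C)) *: x).
(* The pure tensors come from Delta(x e_j) = Delta(x) (e_j ⊗ 1 + omega_j ⊗ e_j). *)
exists (m + m)%N, (dbl (fun k => a k * e j) (fun k => a k * w j)),
  (dbl b (fun k => b k * e j)).
split.
- split; apply: span_add; try exact: SI; first exact/span_scale/SD.
  exact: SD.
- have -> : f i * (x * e j) - x * e j * f i =
     (f i * x - x * f i) * e j + x * (f i * e j - e j * f i).
    by rewrite mulrBl mulrBr !mulrA addrA subrK.
  rewrite comm f_e mulrBl -!mulrA w_e.
  case: eqVneq => [<-|_]; last first.
    rewrite !mul0r !scale0r !addr0 mulr0 addr0 -scalerAr -scalerAl ?mulrA.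
    by [].
  rewrite !mul1r mulrDl mulrDr -!scalerAr mulrBr xwp -!scalerAl scalerBr scalerA !mulrA.
  by rewrite opprD addrACA.
- split; try by move=> k; apply: (dbl_P (P := be)) => // k'; apply: be_mul.
  rewrite (sum_dbl _ _ _ _ (@tensor _ _ _)) rmorphM Dx (coproduct_e hDelta) mulrDr !mulr_suml.
  by congr (_ + _); apply: eq_bigr => k _; rewrite tensor_mul ?mulr1.
- split.
    rewrite (sum_dbl _ _ _ _ (fun x y => phi (f i) y *: x)).
    under eq_bigr do rewrite scalerAl.
    rewrite -mulr_suml bf_p.
    under eq_bigr => k _ do
      rewrite phi_f_mul // phi_1_e mulr0 add0r phi_f_e mulrC -scalerA scalerAl.
    rewrite -scaler_sumr -mulr_suml bw_x mulrDl -!scalerAl -!mulrA w_e -scalerAr.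
    by case: eqVneq => [<-//|_]; rewrite !mul0r !scale0r.
  rewrite (sum_dbl _ _ _ _ (fun x y => phi (wp i) y *: x)).
  under eq_bigr do rewrite scalerAl.
  rewrite -mulr_suml bw_x [X in _ + X]big1 ?addr0 // => k _.
  by rewrite phi_wp_mul // (skew_we hphi) mulr0 scale0r.
- split.
    rewrite (sum_dbl _ _ _ _ (fun x y => phi (f i) x *: y)) addrC.
    congr (_ + _).
      rewrite -af_p mulr_suml; apply: eq_bigr => k _.
      by rewrite phi_f_mul // phi_1_w mulr1 (skew_fw hphi) mulr0 addr0 scalerAl.
    under eq_bigr => k _ do
      rewrite phi_f_mul // phi_1_e mulr0 add0r phi_f_e mulrC -scalerA.
    by rewrite -scaler_sumr aw_x scalerA mulrA.
  rewrite (sum_dbl _ _ _ _ (fun x y => phi (wp i) x *: y)) addrC.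
  rewrite [X in _ + X]big1 ?addr0 => [|k _]; last first.
    by rewrite phi_wp_mul // (skew_we hphi) mulr0 scale0r.
  under eq_bigr => k _ do
    rewrite phi_wp_mul // (skew_ww hphi) mulrC -scalerA scalerAl.
  by rewrite -scaler_sumr -mulr_suml aw_x -scalerAl scalerA [C * _]mulrC.
Qed.

(** Contracting the first leg of Delta(y) with omega_i kills every component containing some f_j
    there, since phi(f_j, omega_i) = 0; only 1 ⊗ y survives. A trailing omega_i is thus invisible to
    words in the f_j. *)
Lemma phi_word_mul_w i (l : seq 'I_n) (y := \prod_(j <- l) f j) x : be x ->
  phi y (x * w i) = phi y x.
Proof.
move=> bx.
have [m [a [b [ba bb Dy yE]]]] : exists m (a b : 'I_m -> U),
    [/\ forall k, bf (a k), forall k, bf (b k), Delta y = \sum_k a k ⊗ b k &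
        \sum_k phi (a k) (w i) *: b k = y].
  rewrite {}/y; elim/last_ind: l => [|l j [m [a [b [ba bb Dy yE]]]]].
    exists 1, (fun=> 1), (fun=> 1); rewrite big_nil !big_ord1 phi_1_w scale1r.
    by split=> //; apply: rmorph1.
  exists (m + m)%N, (dbl a (fun k => a k * f j)), (dbl (fun k => b k * f j) (fun k => b k * wp j)).
  rewrite prod_rcons; split; try by move=> k; apply: (dbl_P (P := bf)) => // k'; apply: bf_mul.
    rewrite (sum_dbl _ _ _ _ (@tensor _ _ _)) rmorphM Dy (coproduct_f hDelta) mulrDr !mulr_suml.
    by congr (_ + _); apply: eq_bigr => k _; rewrite tensor_mul ?mulr1.
  rewrite (sum_dbl _ _ _ _ (fun x y => phi x (w i) *: y)) -[in RHS]yE mulr_suml.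
  rewrite [X in _ + X]big1 ?addr0 => [|k _]; first by apply: eq_bigr => k _; rewrite scalerAl.
  by rewrite phi_mul_w // (skew_fw hphi) mulr0 scale0r.
rewrite (skew_mulr hphi (m := m) (a := a) (b := b)) //.
  2: exact: bf_prod.
by rewrite -[y in RHS]yE phi_suml //; apply: eq_bigr => k _; rewrite mulrC.
Qed.

Lemma be_U_plus z x : U_plus z x -> be x.
Proof. by move=> h; apply: (subalg_closed_span _ h) => _ [l _ ->]; exact: be_prod. Qed.

Lemma bf_U_minus z y : U_minus z y -> bf y.
Proof. by move=> h; apply: (subalg_closed_span _ h) => _ [l _ ->]; exact: bf_prod. Qed.

Lemma phi_U_minus_mul_w i z y x : U_minus z y -> be x -> phi y (x * w i) = phi y x.
Proof.
move=> Uy bx; have by_ := bf_U_minus Uy; elim: Uy by_ => [_|c y1 y2 [l _ ->] U2 IH _].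
  by rewrite !phi_0l //; apply: be_mul.
have b2 : bf y2 by apply: bf_U_minus U2.
by rewrite !(skew_linl hphi) ?IH ?phi_word_mul_w //; apply: be_mul.
Qed.

Definition add_root (z : {ffun 'I_n -> nat}) i : {ffun 'I_n -> nat} :=
  [ffun j => z j + (j == i)]%N.

(** The elements p and p' realize the adjoints of right and left multiplication by f_i. Linearity
    extends them from words to combinations of words; they depend on the chosen combination, hence
    the existential form. *)
Lemma skew_derivation z i x : U_plus (add_root z i) x ->
  exists p p' : U, [/\ U_plus z p, U_plus z p', f i * x - x * f i = p * w i - wp i * p' &
    forall y, U_minus z y -> phi (y * f i) x = phi y p /\ phi (f i * y) x = phi y p'].
Proof.
elim=> [|c x1 x2 [l lz ->] U2 [p2 [p2' [Up2 Up2' comm2 phi2]]]].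
  exists 0, 0; split; try exact: span_zero; first by rewrite mulr0 !mul0r mulr0.
  by move=> y /bf_U_minus by_; rewrite !phi_0r //; apply: bf_mul.
have [p [p' [m [a [b [[Sp Sp'] comm [ba bb Dx] [bf_p _] [af_p _]]]]]]] := skew_derivation_word i l.
have inU q' : span (fun y => exists2 m, perm_eq (i :: m) l & y = \prod_(j <- m) e j) q' -> U_plus z q'.
  apply: span_mono => _ [m' pm ->]; exists m' => // j; have := lz j.
  by rewrite -(permP pm) /= ffunE /= eq_sym addnC => /addIn.
have b2 : be x2 by apply: be_U_plus U2.
exists (c *: p + p2), (c *: p' + p2'); split.
- by apply: span_add => //; apply/span_scale/inU.
- by apply: span_add => //; apply/span_scale/inU.
- rewrite !mulrDr !mulrDl opprD addrACA comm2 -!scalerAl -!scalerAr opprD [RHS]addrACA.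
  by rewrite -!scalerBr comm.
move=> y Uy; have by_ := bf_U_minus Uy; have [h2 h2'] := phi2 _ Uy.
have [bp bp'] : be p /\ be p' by split; apply/(@be_U_plus z)/inU.
have [bp2 bp2'] : be p2 /\ be p2' by split; apply: be_U_plus; eauto.
rewrite !(skew_linr hphi) //; try by apply: bf_mul.
rewrite h2 h2'; split; congr (_ * _ + _).
  rewrite (skew_mull hphi (m := m) (a := a) (b := b)) //.
  (* The contraction recorded for words is p omega_i, not p; the pairing with y does not see the
     omega_i. *)
  rewrite -(phi_U_minus_mul_w i Uy bp) -bf_p phi_sumr //.
  by apply: eq_bigr => k _; rewrite mulrC.
rewrite (skew_mull hphi (m := m) (a := a) (b := b)) // -af_p phi_sumr //.
Qed.

(** Both skew derivations of a word lie in the span of words with one letter i removed; when the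
    letter does not occur, this span is zero. *)
Lemma f_U_plus_comm (z : {ffun 'I_n -> nat}) i x : z i = 0%N -> U_plus z x -> f i * x = x * f i.
Proof.
move=> zi; elim=> [|c x1 x2 [l lz ->] U2 IH]; first by rewrite mulr0 mul0r.
rewrite mulrDr mulrDl IH -scalerAr -scalerAl; congr (_ *: _ + _); apply/eqP; rewrite -subr_eq0.
have [p [p' [_ [_ [_ [[Sp Sp'] -> _ _ _]]]]]] := skew_derivation_word i l.
have noS y : ~ (exists2 m, perm_eq (i :: m) l & y = \prod_(j <- m) e j).
  by case=> m pm _; have := lz i; rewrite zi -(permP pm) /= eqxx.
by rewrite (span_empty noS Sp) (span_empty noS Sp') mul0r mulr0 subrr.
Qed.

Section DualBases.
Variables (d : {ffun 'I_n -> nat} -> nat) (u v : forall z, 'I_(d z) -> U).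
Arguments u : clear implicits.
Arguments v : clear implicits.
Hypothesis hu : forall z, is_basis (U_plus z) (u z).
Hypothesis hv : forall z, is_basis (U_minus z) (v z).
Hypothesis huv : forall z k l, phi (v z k) (u z l) = (k == l)%:R.

Lemma U_plus_u z k : U_plus z (u z k). Proof. by case: (hu z). Qed.
Lemma U_minus_v z k : U_minus z (v z k). Proof. by case: (hv z). Qed.

Lemma U_plus_expand z x : U_plus z x -> x = \sum_k phi (v z k) x *: u z k.
Proof.
case: (hu z) => Pu gen _ /gen[c ->]; apply: eq_bigr => k _; congr (_ *: _).
rewrite phi_sumr.
- rewrite (bigD1 k) //= huv eqxx mulr1 big1 ?addr0 // => l lk.
  by rewrite huv eq_sym (negbTE lk) mulr0.
- exact: bf_U_minus (U_minus_v k).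
- by move=> l; apply: be_U_plus (U_plus_u l).
Qed.

Lemma U_minus_expand z y : U_minus z y -> y = \sum_k phi y (u z k) *: v z k.
Proof.
case: (hv z) => Pv gen _ /gen[c ->]; apply: eq_bigr => k _; congr (_ *: _).
rewrite phi_suml.
- rewrite (bigD1 k) //= huv eqxx mulr1 big1 ?addr0 // => l lk.
  by rewrite huv (negbTE lk) mulr0.
- exact: be_U_plus (U_plus_u k).
- by move=> l; apply: bf_U_minus (U_minus_v l).
Qed.

Lemma f_U_plus_commutator z i x : U_plus (add_root z i) x ->
  f i * x - x * f i = \sum_k phi (v z k * f i) x *: (u z k * w i)
                      - \sum_k phi (f i * v z k) x *: (wp i * u z k).
Proof.
case/skew_derivation=> p [p' [/U_plus_expand pE /U_plus_expand p'E -> h]].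
rewrite pE p'E mulr_suml mulr_sumr.
by congr (_ - _); apply: eq_bigr => k _; have [h1 h2] := h _ (U_minus_v k);
  rewrite ?h1 ?h2 -?scalerAl -?scalerAr.
Qed.

Lemma U_minus_mul_f z i y : U_minus z y ->
  U_minus (add_root z i) (y * f i) /\ U_minus (add_root z i) (f i * y).
Proof.
move=> Uy; split; move: Uy.
  apply: (@span_linear _ _ _ (fun y : U => y * f i)) => [c a b|_ [l lz ->]].
    by rewrite mulrDl scalerAl.
  apply: span_incl; exists (rcons l i); rewrite ?prod_rcons // => j.
  by rewrite -cats1 count_cat lz ffunE /= addn0 eq_sym.
apply: (@span_linear _ _ _ (fun y : U => f i * y)) => [c a b|_ [l lz ->]].
  by rewrite mulrDr scalerAr.
apply: span_incl; exists (i :: l); rewrite ?big_cons // => j.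
by rewrite /= lz ffunE addnC eq_sym.
Qed.

End DualBases.

End Pairing.

(** * Bilinearity of the Kronecker product; strictly upper triangular matrices *)

Section TensorProduct.
Variable K : fieldType.
Implicit Types m p q t : nat.

Lemma tensmx_linl m p q t (B : 'M[K]_(q, t)) : linear (fun A : 'M[K]_(m, p) => A *t B).
Proof.
move=> c A A'; apply/matrixP => i j.
case: (mxtens_indexP i) => i1 i2; case: (mxtens_indexP j) => j1 j2.
by rewrite !mxE !mxtens_indexK /= mulrDl mulrA.
Qed.

Lemma tensmx_linr m p q t (A : 'M[K]_(m, p)) : linear (fun B : 'M[K]_(q, t) => A *t B).
Proof.
move=> c B B'; apply/matrixP => i j.
case: (mxtens_indexP i) => i1 i2; case: (mxtens_indexP j) => j1 j2.
by rewrite !mxE !mxtens_indexK /= mulrDr mulrCA.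
Qed.

Section Sums.
Variables m p q t : nat.
Implicit Types (A : 'M[K]_(m, p)) (B : 'M[K]_(q, t)) (c : K).

Lemma tensmxDl A A' B : (A + A') *t B = A *t B + A' *t B.
Proof. by have := tensmx_linl B 1 A A'; rewrite !scale1r. Qed.

Lemma tensmxDr A B B' : A *t (B + B') = A *t B + A *t B'.
Proof. by have := tensmx_linr A 1 B B'; rewrite !scale1r. Qed.

Lemma tensmxZl c A B : (c *: A) *t B = c *: (A *t B).
Proof. by have := tensmx_linl B c A 0; rewrite !addr0 tens0mx addr0. Qed.

Lemma tensmxZr c A B : A *t (c *: B) = c *: (A *t B).
Proof. by have := tensmx_linr A c B 0; rewrite !addr0 tensmx0 addr0. Qed.

Lemma tensmxBr A B B' : A *t (B - B') = A *t B - A *t B'.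
Proof. by rewrite tensmxDr -scaleN1r tensmxZr scaleN1r. Qed.

Lemma tensmx_suml I (l : seq I) (P : pred I) (F : I -> 'M[K]_(m, p)) B :
  (\sum_(i <- l | P i) F i) *t B = \sum_(i <- l | P i) F i *t B.
Proof.
apply: (big_morph (fun A => A *t B)) => [A A'|]; first exact: tensmxDl.
exact: tens0mx.
Qed.

Lemma tensmx_sumr I (l : seq I) (P : pred I) A (F : I -> 'M[K]_(q, t)) :
  A *t (\sum_(i <- l | P i) F i) = \sum_(i <- l | P i) A *t F i.
Proof.
apply: (big_morph (fun B => A *t B)) => [B B'|]; first exact: tensmxDr.
exact: tensmx0.
Qed.

End Sums.
End TensorProduct.

Lemma tensmx11 (R : comPzRingType) m p : (1%:M : 'M[R]_m) *t (1%:M : 'M[R]_p) = 1%:M.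
Proof.
apply/matrixP => i j; case: (mxtens_indexP i) => i1 i2; case: (mxtens_indexP j) => j1 j2.
by rewrite tensmxE !mxE (can_eq (@mxtens_indexK _ _)) xpair_eqE -natrM mulnb.
Qed.

Section StrictlyUpper.
Variables (K : fieldType) (N : nat).

Definition upper k (A : 'M[K]_N) := forall a b : 'I_N, (b < a + k)%N -> A a b = 0.

Lemma upper_mul k l A B : upper k A -> upper l B -> upper (k + l) (A *m B).
Proof.
move=> uA uB a b ab; rewrite mxE big1 // => c _.
case: (ltnP c (a + k)) => ck; first by rewrite uA // mul0r.
by rewrite uB ?mulr0 //; apply: leq_trans ab _; rewrite addnA leq_add2r.
Qed.

Lemma upper_lin k c A B : upper k A -> upper k B -> upper k (A + c *: B).
Proof. by move=> uA uB a b ab; rewrite !mxE uA ?uB // mulr0 addr0. Qed.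

Lemma upper_scale k c A : upper k A -> upper k (c *: A).
Proof. by move=> uA a b ab; rewrite !mxE uA ?mulr0. Qed.

Lemma upper_delta (i j : 'I_N) : (i < j)%N -> upper 1 (delta_mx i j).
Proof.
move=> ij a b ab; rewrite mxE; case: eqVneq => //= ai; case: eqVneq => //= bj.
by move: ab; rewrite ai bj addn1 ltnS leqNgt ij.
Qed.

Lemma upper_eq0 k A : (N <= k)%N -> upper k A -> A = 0.
Proof.
move=> Nk uA; apply/matrixP => a b; rewrite mxE uA //.
by apply: leq_trans (ltn_ord b) _; apply: leq_trans Nk (leq_addl _ _).
Qed.

End StrictlyUpper.

(** * The action of Theta on V ⊗ V and its intertwining property *)

Section Theta.
Variables (n : nat) (K : fieldType) (r s : K).
Hypotheses (r0 : r != 0) (s0 : s != 0) (rms : r - s != 0) (rps : r + s != 0).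
Hypothesis n0 : (0 < n)%N.
Variables (Delta : {rmorphism U n r s -> tens (U n r s) (U n r s)}).
Hypothesis hDelta : coproduct Delta.
Variables (phi : U n r s -> U n r s -> K).
Hypothesis hphi : skew_pairing Delta phi.
Variables (d : {ffun 'I_n -> nat} -> nat) (u v : forall z, 'I_(d z) -> U n r s).
Arguments u : clear implicits.
Arguments v : clear implicits.
Hypothesis hu : forall z, is_basis (U_plus z) (u z).
Hypothesis hv : forall z, is_basis (U_minus z) (v z).
Hypothesis huv : forall z k l, phi (v z k) (u z l) = (k == l)%:R.
Local Notation N := (n.*2.+1).
Variable rho : {lrmorphism U n r s -> 'M[K]_N}.

Local Notation e i := (ue r s i).
Local Notation f i := (uf r s i).
Local Notation w i := (uw r s i).
Local Notation wp i := (uwp r s i).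
Local Notation T z := (\sum_k (rho (v z k) *t rho (u z k))).

Let rhoM x y : rho (x * y) = rho x *m rho y. Proof. exact: rmorphM. Qed.

(** Commuting f_i past the second leg at weight z + alpha_i expresses everything in the u of weight
    z; by duality the coefficients are those of v_k f_i and f_i v_k in the basis of weight -(z +
    alpha_i). *)
Lemma Theta_commutator (z : {ffun 'I_n -> nat}) i (F := rho (f i)) :
  1%:M *t F *m T (add_root z i) - T (add_root z i) *m (1%:M *t F) =
  T z *m (F *t rho (w i)) - F *t rho (wp i) *m T z.
Proof.
rewrite !mulmx_sumr !mulmx_suml -!sumrB.
under eq_bigr => k _.
  rewrite !tensmx_mul mulmx1 mul1mx /F -!rhoM -tensmxBr -raddfB /=.
  rewrite (f_U_plus_commutator r0 s0 rms rps hDelta hphi hu hv huv (U_plus_u hu k)).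
  rewrite [rho (_ - _)]raddfB /= ![rho (\sum_(_ <- _) _)]raddf_sum tensmxBr !tensmx_sumr.
  over.
rewrite /= sumrB exchange_big /= [X in _ - X]exchange_big -sumrB /=; apply: eq_bigr => k _.
rewrite !tensmx_mul /F -!rhoM; have [U1 U2] := U_minus_mul_f i (U_minus_v hv k).
(* This expansion reassembles the inner sums over the basis at z + alpha_i into rho(v_k f_i) and
   rho(f_i v_k). *)
have rhoE y : U_minus (add_root z i) y ->
    rho y = \sum_l phi y (u (add_root z i) l) *: rho (v (add_root z i) l).
  move/(U_minus_expand hphi hu hv huv) => {1}->; rewrite raddf_sum.
  by apply: eq_bigr => l _; exact: linearZZ.
rewrite (rhoE _ U1) (rhoE _ U2) !tensmx_suml; congr (_ - _); apply: eq_bigr => l _;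
  by rewrite !linearZ /= tensmxZl tensmxZr.
Qed.

Lemma Theta_commutator0 (z : {ffun 'I_n -> nat}) i (F := rho (f i)) : z i = 0%N ->
  1%:M *t F *m T z - T z *m (1%:M *t F) = 0.
Proof.
move=> zi; rewrite mulmx_sumr mulmx_suml -sumrB big1 // => k _.
rewrite !tensmx_mul mulmx1 mul1mx /F -!rhoM.
by rewrite (f_U_plus_comm r0 s0 rms rps hDelta hphi zi) ?subrr //; apply: U_plus_u.
Qed.

Hypothesis rho_e : forall i, upper 1 (rho (e i)).

Lemma rho_U_plus_eq0 (z : {ffun 'I_n -> nat}) i x : U_plus z x -> (N <= z i)%N -> rho x = 0.
Proof.
move=> Ux zi; elim: Ux => [|c y1 y2 [l lz ->] _ IH]; first exact: raddf0.
rewrite linearD linearZ /= IH addr0.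
have up (l' : seq 'I_n) : upper (size l') (rho (\prod_(j <- l') e j)).
  elim: l' => [|j l' IHl] /=.
    rewrite big_nil rmorph1 => a b; rewrite addn0 mxE => ba.
    by case: eqVneq => [ab|//]; move: ba; rewrite ab ltnn.
  by rewrite big_cons rhoM -[(size l').+1]add1n; apply: (upper_mul (rho_e j) IHl).
rewrite (upper_eq0 _ (up l)) ?scaler0 //; apply: leq_trans zi _.
by rewrite -lz count_size.
Qed.

(* The e-words with N or more letters act by 0 on V, so only the weights in this
   box contribute to Theta. *)
Definition weight_box : seq {ffun 'I_n -> nat} :=
  [seq [ffun i => z i : nat] | z : {ffun 'I_n -> 'I_N}].

Lemma weight_box_uniq : uniq weight_box.
Proof.
rewrite map_inj_uniq ?enum_uniq // => z1 z2 /ffunP z12; apply/ffunP => i.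
by apply: val_inj; have := z12 i; rewrite !ffunE.
Qed.

Lemma notin_weight_box z : z \notin weight_box -> exists i, (N <= z i)%N.
Proof.
move=> zb; apply/existsP; apply: contraR zb => /existsPn zN.
apply/mapP; exists [ffun i => inord (z i)]; rewrite ?mem_enum //.
apply/ffunP => i; rewrite !ffunE inordK //; have := zN i; by rewrite -ltnNge.
Qed.

(** A sum over all weights is 0 by convention when its support is infinite, so it becomes an honest
    sum only once the support is confined to the box. *)
Lemma fsum_box (V : zmodType) (G : {ffun 'I_n -> nat} -> V) :
  (forall (z : {ffun 'I_n -> nat}) i, (N <= z i)%N -> G z = 0) ->
  \sum_(z \in [set: {ffun 'I_n -> nat}]%classic) G z = \sum_(z <- weight_box) G z.
Proof.
move=> G0; rewrite (@fsbigE _ _ _ _ _ weight_box) ?weight_box_uniq //.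
  by apply: eq_bigl => z; rewrite in_setT.
by move=> z _ /notin_weight_box[i /G0].
Qed.

Lemma rho_u_eq0 (z : {ffun 'I_n -> nat}) i k : (N <= z i)%N -> rho (u z k) = 0.
Proof. by apply: rho_U_plus_eq0; apply: U_plus_u. Qed.

Lemma Theta_box : Theta_VV rho u v = \sum_(z <- weight_box) T z.
Proof.
apply: fsum_box => z i zi; apply: big1 => k _.
by rewrite (rho_u_eq0 _ zi) tensmx0.
Qed.

Lemma Theta_intertwines i :
  (1%:M *t rho (f i) + rho (f i) *t rho (wp i)) *m Theta_VV rho u v =
  Theta_VV rho u v *m (1%:M *t rho (f i) + rho (f i) *t rho (w i)).
Proof.
have T0 (z : {ffun 'I_n -> nat}) j : (N <= z j)%N -> T z = 0.
  by move=> zj; apply: big1 => k _; rewrite (rho_u_eq0 _ zj) tensmx0.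
pose G z := 1%:M *t rho (f i) *m T z - T z *m (1%:M *t rho (f i)).
pose H z := T z *m (rho (f i) *t rho (w i)) - rho (f i) *t rho (wp i) *m T z.
have G0 (z : {ffun 'I_n -> nat}) j : (N <= z j)%N -> G z = 0.
  by move=> zj; rewrite /G (T0 _ _ zj) mul0mx mulmx0 subrr.
have H0 (z : {ffun 'I_n -> nat}) j : (N <= z j)%N -> H z = 0.
  by move=> zj; rewrite /H (T0 _ _ zj) mul0mx mulmx0 subrr.
have GH : \sum_(z <- weight_box) G z = \sum_(z <- weight_box) H z.
  (* The shift z -> z + alpha_i does not preserve the box, so the reindexing is done over all
     weights, where it is injective with image the weights having positive i-th coordinate. *)
  rewrite -(fsum_box G0) -(fsum_box H0).
  rewrite -(@fsbig_widen _ _ _ _ [set add_root z i | z in [set: _]]%classic) //; last first.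
    (* A weight outside the image of the shift has i-th coordinate 0, where the commutator
       vanishes. *)
    move=> z [_ /= zr]; apply: Theta_commutator0.
    case zi : (z i) => [//|m]; case: zr; exists [ffun j => z j - (j == i)]%N => //.
    apply/ffunP => j; rewrite !ffunE subnK //; case: eqVneq => // ->; by rewrite zi.
  rewrite fsbig_image /=; first by apply: eq_fsbigr => z _; apply: Theta_commutator.
  move=> z1 z2 _ _ /ffunP z12; apply/ffunP => j; have := z12 j.
  by rewrite !ffunE => /addIn.
apply/eqP; rewrite mulmxDl mulmxDr -subr_eq0 opprD addrACA addr_eq0 opprB Theta_box.
rewrite !mulmx_sumr !mulmx_suml -!sumrB; exact/eqP.
Qed.

Lemma Theta_0 : T [ffun=> 0%N] = 1%:M.
Proof.
pose z0 : {ffun 'I_n -> nat} := [ffun=> 0%N]; rewrite -/z0.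
have word0 (l : seq 'I_n) : (forall i, count_mem i l = z0 i) -> l = [::].
  by case: l => [//|i l] /(_ i); rewrite ffunE /= eqxx.
have U1 : U_plus z0 (1 : U n r s).
  by apply: span_incl; exists [::]; rewrite ?big_nil // => i; rewrite ffunE.
(* In weight 0 the only word is empty, so each dual vector is a scalar; moving it across the tensor
   leaves the dual-basis expansion of 1. *)
have V1 k : exists c, v z0 k = c%:A.
  have := U_minus_v hv k; elim=> [|c x y [l /word0 -> ->] _ [c' ->]].
    by exists 0; rewrite scale0r.
  by exists (c + c'); rewrite big_nil scalerDl.
suff -> : T z0 = \sum_k phi (v z0 k) 1 *: (1%:M *t rho (u z0 k)).
  under eq_bigr do rewrite -tensmxZr -linearZ.
  rewrite -tensmx_sumr -raddf_sum /= -(U_plus_expand hphi hu hv huv U1).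
  by rewrite (rmorph1 rho); apply: tensmx11.
apply: eq_bigr => k _; have [c ->] := V1 k.
have -> : phi c%:A 1 = c.
  have b1 := bf1 n r s; have e1 := be1 n r s.
  have b0 : borel_f (0 : U n r s) by rewrite -[0](scale0r 1); apply: subalg_const.
  rewrite -[c%:A]addr0 (skew_linl hphi) // (phi_1_1 rms rps n0 hDelta hphi).
  by rewrite (phi_0l hphi) // addr0 mulr1.
by rewrite linearZ rmorph1 tensmxZl.
Qed.

Lemma rho_U_plus_highest (z : {ffun 'I_n -> nat}) (y : 'cV[K]_N) x :
  (forall i, rho (e i) *m y = 0) -> z != [ffun=> 0%N] -> U_plus z x -> rho x *m y = 0.
Proof.
move=> y0 z0; elim=> [|c x1 x2 [l lz ->] _ IH]; first by rewrite raddf0 mul0mx.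
rewrite linearD linearZ /= mulmxDl IH addr0 -scalemxAl.
(* The rightmost letter of the word acts first, and it kills y. *)
case/lastP: l lz => [|l j] lz.
  by case/eqP: z0; apply/ffunP => i; rewrite ffunE -lz.
by rewrite prod_rcons rhoM -mulmxA y0 mulmx0 scaler0.
Qed.

Lemma Theta_highest (x y : 'cV[K]_N) :
  (forall i, rho (e i) *m y = 0) -> Theta_VV rho u v *m (x *t y) = x *t y.
Proof.
move=> y0; rewrite Theta_box mulmx_suml (bigD1_seq [ffun=> 0%N]) ?weight_box_uniq //=.
  rewrite Theta_0 mul1mx big1 ?addr0 // => z z0; rewrite mulmx_suml big1 // => k _.
  by rewrite tensmx_mul (rho_U_plus_highest y0 z0) ?tensmx0 //; apply: U_plus_u.
by apply: contraT => /notin_weight_box[i]; rewrite ffunE.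
Qed.

End Theta.

(** * Scalar identities behind the closed form *)

Lemma natr_if (R : pzSemiRingType) (c : bool) : c%:R = if c then 1 else 0 :> R.
Proof. by case: c. Qed.

(** Conditions free of nested [if] are split first; [lia] discards the impossible positions of the
    indices, leaving one rational identity per case. *)
Ltac case_ifs := repeat match goal with
  |- context [if ?c then _ else _] =>
    lazymatch c with context [if _ then _ else _] => fail | _ => idtac end;
    case: (boolP c) => ? //; try (exfalso; lia) end.

Section Scalars.
Variables (n : nat) (K : fieldType) (r s sqr sqs sqrs : K).
Hypotheses (r0 : r != 0) (s0 : s != 0) (rps : r + s != 0).
Hypotheses (sqrE : sqr ^+ 2 = r) (sqsE : sqs ^+ 2 = s) (sqrsE : sqrs ^+ 2 = r + s).
Implicit Types i a b c : nat.

(* The eigenvalue on v_b of omega_(i+1), resp. omega'_(i+1) after exchanging r and s. *)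
Definition ev (x y : K) i b : K :=
  if i.+1 == n then
    if b == n then x / y else if b == n.+1 then 1 else if b == n.+2 then x^-1 * y
    else if (b < n)%N then (x * y)^-1 else x * y
  else if b == i.+1 then x ^+ 2 else if b == i.+2 then y ^+ 2
  else if b == pr n i.+2 then y ^- 2 else if b == pr n i.+1 then x ^- 2 else 1.

(* f_(i+1) v_b = fcoef i b v_(b+1) *)
Definition fcoef i b : K :=
  if i.+1 == n then
    if b == n then sqrs * (sqr * sqs)^-1 else if b == n.+1 then - (sqrs * s^-1) else 0
  else if b == i.+1 then 1 else if b == pr n i.+2 then - (r * s)^-1 else 0.

(* The coefficient of v_b (x) v_a in R (v_a (x) v_b). *)
Definition lead a b : K :=
  if a == n.+1 then 1 else if b == n.+1 then 1
  else if a == b then r^-1 * s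
  else if (a + b == n.*2.+2)%N then r * s^-1
  else if (if (a <= n)%N then if (b <= n)%N then (a < b)%N else (n.*2.+2 < a + b)%N
           else if (b <= n)%N then (a + b < n.*2.+2)%N else (b < a)%N) then r * s
  else r^-1 * s^-1.

(** This is (s/r)^(rho_c): the base is a square root of s/r and [rho2] doubles the exponent. *)
Definition qpow c : K := (sqr^-1 * sqs) ^ rho2 n c.

Local Notation k := (r^-1 * s - r * s^-1).

Lemma fcoef_neq0 i b : (i < n)%N -> fcoef i b != 0 ->
  if i.+1 == n then (b == n) || (b == n.+1) else (b == i.+1) || (b == pr n i.+2).
Proof.
rewrite /fcoef => ni; case: ifP => _; case: ifP => // _; case: ifP => // _; by rewrite eqxx.
Qed.

Lemma fcoef_ge i b : (i < n)%N -> (n.*2.+1 <= b)%N -> fcoef i b = 0.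
Proof.
move=> ni bN; apply/eqP; apply: contraT => /(fcoef_neq0 ni).
by case: ifP; rewrite /pr; lia.
Qed.

Lemma fcoef_exists b : (0 < n)%N -> (0 < b <= n.*2)%N -> exists2 i, (i < n)%N & fcoef i b != 0.
Proof.
move=> n0 bn.
have q0 : sqr != 0 by move: r0; rewrite -sqrE expf_eq0.
have q1 : sqs != 0 by move: s0; rewrite -sqsE expf_eq0.
have q2 : sqrs != 0 by move: rps; rewrite -sqrsE expf_eq0.
have [bn'|nb] := ltnP b n.
  (* The three witnesses solve b = i+1 for b < n, i+1 = n for b = n or n+1, and b = (i+2)' = 2n - i
     beyond. *)
  exists b.-1; first lia.
  rewrite /fcoef prednK ?eqxx ?oner_eq0; last lia.
  by rewrite (_ : (b == n) = false) ?oner_eq0; last lia.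
have [bn'|nb'] := leqP b n.+1.
  exists n.-1; first lia.
  rewrite /fcoef prednK // eqxx; case: ifP => bn''; first by rewrite mulf_neq0 ?invr_eq0 ?mulf_neq0.
  by rewrite ifT ?oppr_eq0 ?mulf_neq0 ?invr_eq0; last lia.
exists (n.*2 - b)%N; first lia.
rewrite /fcoef /pr ifF; last lia.
rewrite ifF; last lia.
by rewrite ifT ?oppr_eq0 ?invr_eq0 ?mulf_neq0; last lia.
Qed.


Lemma ev_neq0 x y i b : x != 0 -> y != 0 -> ev x y i b != 0.
Proof.
by move=> x0 y0; rewrite /ev; repeat case: ifP => _;
  rewrite ?oner_eq0 ?mulf_neq0 ?invr_eq0 ?mulf_neq0 ?expf_neq0.
Qed.

Lemma lead_step i a b : (i < n)%N -> (0 < a <= n.*2.+1)%N -> (0 < b <= n.*2.+1)%N ->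
  fcoef i a != 0 -> lead a.+1 b * ev s r i b = lead a b.
Proof.
clear sqrE sqsE.
move=> ni aN bN /(fcoef_neq0 ni) fa; rewrite /lead /ev /pr; rewrite /pr in fa.
case: ifP fa => [/eqP n_i|n_i] /orP[] /eqP aE; subst; try subst n;
  case_ifs; field; rewrite ?r0 ?s0 //.
Qed.

(* The coefficient of v_(b+1) (x) v_a in the commutator of the closed form of R
   with the coproduct of f_(i+1), applied to v_a (x) v_b. *)
Lemma lead_exchange i a b : (i < n)%N -> (0 < a <= n.*2.+1)%N -> (0 < b <= n.*2.+1)%N ->
  fcoef i b != 0 ->
  lead a b.+1 - k * (a == b.+1)%:R + k * ev s r i b * (a == b)%:R
  + k * (a + b == n.*2.+1)%N%:R
  - lead a b * ev s r i a - k * ev s r i a * (a + b == n.*2.+2)%N%:R = 0.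
Proof.
clear sqrE sqsE.
move=> ni aN bN /(fcoef_neq0 ni) fb; rewrite !natr_if /lead /ev /pr; rewrite /pr in fb.
case: ifP fb => [/eqP n_i|n_i] /orP[] /eqP bE; subst; try subst n;
  case_ifs; field; rewrite ?r0 ?s0 //.
Qed.

(* Consecutive terms of the sum of the (s/r)^rho_c v_c (x) v_(c') cancel under
   the coproduct of f_(i+1). *)
Lemma qpow_telescope i c : (i < n)%N -> (0 < c <= n.*2)%N ->
  qpow c.+1 * fcoef i (n.*2.+1 - c) + qpow c * fcoef i c * ev s r i (n.*2.+2 - c) = 0.
Proof.
move=> ni cN; rewrite /qpow.
have q0 : sqr != 0 by move: r0; rewrite -sqrE expf_eq0.
have q1 : sqs != 0 by move: s0; rewrite -sqsE expf_eq0.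
have u0 : sqr^-1 * sqs != 0 by rewrite mulf_neq0 ?invr_eq0.
(* The reflection c -> 2n+1-c swaps the two special positions, so outside them both coefficients
   vanish. *)
pose special b := if i.+1 == n then (b == n) || (b == n.+1) else (b == i.+1) || (b == pr n i.+2).
have [cs|cs] := boolP (special c); last first.
  rewrite (_ : fcoef i c = 0); last by apply: contraNeq cs; apply: fcoef_neq0.
  rewrite (_ : fcoef i (_ - c) = 0) ?mulr0 ?mul0r ?addr0 //.
  apply: contraNeq cs => /(fcoef_neq0 ni); rewrite /special /pr; case: ifP => _; lia.
(* The exponent rho drops by 1 at each step, except for the two half steps around the zero
   weight. *)
have -> : rho2 n c = rho2 n c.+1 + (if (c == n) || (c == n.+1) then 1 else 2).
  by rewrite /rho2 /pr; case_ifs; lia.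
rewrite expfzDr // -!mulrA -mulrDr; apply/eqP; rewrite mulf_eq0; apply/orP; right; apply/eqP.
move: cs; rewrite /special /pr; case: ifP => [/eqP n_i|n_i] /orP[] /eqP cE.
all: clear special.
all: rewrite /fcoef /ev /pr -sqrE -sqsE.
all: case_ifs.
all: rewrite ?expr1z -?[_ ^ 2]exprnP; field; rewrite ?q0 ?q1 //.
Qed.

Let setAE a b : (0 < a <= n.*2.+1)%N -> (0 < b <= n.*2.+1)%N -> setA n a b =
  if (a <= n)%N then if (b <= n)%N then (a < b)%N else (n.*2.+2 < a + b)%N else false.
Proof. by rewrite /setA /pr => aN bN; do 2?[case: ifP => ?]; lia. Qed.

Let setBE a b : (0 < a <= n.*2.+1)%N -> (0 < b <= n.*2.+1)%N -> setB n a b =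
  if (b <= n.+1)%N then false else if (a <= n)%N then (a + b < n.*2.+2)%N
  else if a == n.+1 then false else (a < b)%N.
Proof. by rewrite /setB /pr => aN bN; do 3?[case: ifP => ?]; lia. Qed.

(** The right side collects what each exchange-type sum of the closed form contributes to v_b ⊗ v_a;
    the index sets are disjoint and exhaust all pairs, so exactly one indicator is 1. *)
Lemma lead_sum a b : (0 < a <= n.*2.+1)%N -> (0 < b <= n.*2.+1)%N ->
  lead a b =
  r^-1 * s * ((b == a) && (a != pr n a))%:R
  + r^-1 * s^-1 * ((setA n b a)%:R + (setB n a b)%:R)
  + r * s * ((setA n a b)%:R + (setB n b a)%:R)
  + ((a == n.+1) && (b != pr n b))%:R + ((b == n.+1) && (a != pr n a))%:R
  + r * s^-1 * ((b == pr n a) && (a != pr n a))%:R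
  + ((a == n.+1) && (b == n.+1))%:R.
Proof.
clear sqrE sqsE sqrsE => aN bN; rewrite !setAE ?setBE // !natr_if /lead /pr.
have andE (x y : bool) : x && y = if x then y else false by [].
rewrite !andE {andE}.
by case_ifs; ring.
Qed.

End Scalars.

Lemma wt_if n b (j : 'I_n) : wt b j =
  if (b <= n)%N then if (b <= j.+1)%N then 1 else 0 else if b == n.+1 then 0
  else if (pr n b <= j.+1)%N then -1 else 0.
Proof.
rewrite /wt /eps; case: ifP => _; first by case: ifP.
by case: ifP => // _; case: ifP.
Qed.

(** * Structure constants as eigenvalues of omega_i and omega'_i *)

Section CstLattice.
Variables (n : nat) (K : fieldType) (r s : K).
Hypotheses (r0 : r != 0) (s0 : s != 0).
Local Notation N := n.*2.+1.

Lemma prod_neighbours (i : nat) (F : nat -> K) : (i < n)%N ->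
  (forall j, (j.+1 < i)%N || (i.+1 < j)%N -> F j = 1) ->
  \prod_(j < n) F j =
  (if (0 < i)%N then F i.-1 else 1) * F i * (if (i.+1 < n)%N then F i.+1 else 1).
Proof.
move=> ni F1; rewrite -(big_mkord xpredT) (@big_cat_nat _ _ _ i) //=; last exact: ltnW.
rewrite -mulrA; congr (_ * _).
  case: i ni F1 => [|i] ni F1; first by rewrite big_geq.
  rewrite big_nat_recr //= big1_seq ?mul1r // => j; rewrite mem_index_iota => ji.
  by apply: F1; rewrite ltnS; lia.
rewrite big_ltn //; congr (_ * _); case: ltnP => ni'; last by rewrite big_geq.
rewrite big_ltn // big1_seq ?mulr1 // => j; rewrite mem_index_iota => ji.
by apply: F1; lia.
Qed.

(** A copy of [cst] on natural numbers, so that the neighbours i-1 and i+1 can be substituted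
    without building ordinals. *)
Let cstn i j : K :=
  if i == j then (if i.+1 == n then r / s else r ^+ 2 / s ^+ 2)
  else if j == i.+1 then r ^- 2 else if i == j.+1 then s ^+ 2 else 1.

Let wtn b j : int :=
  if (b <= n)%N then if (b <= j.+1)%N then 1 else 0 else if b == n.+1 then 0
  else if (pr n b <= j.+1)%N then -1 else 0.

Let wtnE b (j : 'I_n) : @wt n b j = wtn b j. Proof. exact: wt_if. Qed.

(** On weight lambda, omega'_i acts by the inverse of the constant pairing it with omega_lambda,
    while omega_i acts by the constant itself; hence the inverse here and none in [prod_cst_wt_l].
    Only the neighbours of i contribute to the product. *)
Lemma prod_cst_wt_r (i : 'I_n) b : (0 < b <= N)%N ->
  \prod_j cst r s i j ^ wt b j = (ev n s r i b)^-1.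
Proof.
move=> bN; under eq_bigr => j _ do rewrite wtnE [cst r s i j]/(cstn i j).
rewrite (prod_neighbours (i := i) (F := fun j => cstn i j ^ wtn b j)) //; last first.
  move=> j ij; rewrite /cstn ifF; last lia.
  rewrite ifF; last lia.
  by rewrite ifF ?exp1rz; last lia.
have := ltn_ord i; move: (i : nat) => {}i ni.
rewrite /cstn /wtn /ev /pr; case_ifs.
all: rewrite ?expr0z ?expr1z ?exprN1; field; rewrite ?oner_eq0 ?r0 ?s0 //.
Qed.

Lemma prod_cst_wt_l (i : 'I_n) b : (0 < b <= N)%N ->
  \prod_j cst r s j i ^ wt b j = ev n r s i b.
Proof.
move=> bN; under eq_bigr => j _ do rewrite wtnE [cst r s j i]/(cstn j i).
rewrite (prod_neighbours (i := i) (F := fun j => cstn j i ^ wtn b j)) //; last first.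
  move=> j ij; rewrite /cstn ifF; last lia.
  rewrite ifF; last lia.
  by rewrite ifF ?exp1rz; last lia.
have := ltn_ord i; move: (i : nat) => {}i ni.
rewrite /cstn /wtn /ev /pr; case_ifs.
all: rewrite ?expr0z ?expr1z ?exprN1; field; rewrite ?oner_eq0 ?r0 ?s0 //.
Qed.

End CstLattice.

(** * Sums of matrix units acting on basis vectors of V ⊗ V *)

Section Vectors.
Variables (n : nat) (K : fieldType).
Local Notation N := n.*2.+1.
Implicit Types a b c : nat.

Definition bvec a : 'cV[K]_N := delta_mx (inord a.-1) 0.
Definition bvec2 a b : 'M[K]_(N * N, 1 * 1) := bvec a *t bvec b.

Lemma inord_eq a b : (0 < a <= N)%N -> (0 < b <= N)%N ->
  (inord a.-1 == inord b.-1 :> 'I_N) = (a == b).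
Proof. by move=> aN bN; rewrite -val_eqE /= !inordK; lia. Qed.

Lemma E_bvec a b c : (0 < b <= N)%N -> (0 < c <= N)%N ->
  E a b *m bvec c = (b == c)%:R *: bvec a.
Proof.
by move=> bN cN; rewrite /E /bvec mul_delta_mx_cond inord_eq // scaler_nat.
Qed.

Lemma EE_bvec2 a b c d x y : (0 < b <= N)%N -> (0 < d <= N)%N ->
  (0 < x <= N)%N -> (0 < y <= N)%N ->
  E a b *t E c d *m bvec2 x y = (b == x)%:R *: ((d == y)%:R *: bvec2 a c).
Proof. by move=> *; rewrite tensmx_mul !E_bvec // tensmxZl tensmxZr. Qed.

Lemma bvec2_ext (A B : 'M[K]_(N * N)) :
  (forall a b, (0 < a <= N)%N -> (0 < b <= N)%N -> A *m bvec2 a b = B *m bvec2 a b) -> A = B.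
Proof.
move=> AB; apply/matrixP => i j; case: (mxtens_indexP j) => a b.
have := AB a.+1 b.+1 (ltn_ord a) (ltn_ord b).
have -> : bvec2 a.+1 b.+1 = delta_mx (mxtens_index (a, b)) 0.
  apply/matrixP => p q; case: (mxtens_indexP p) => p1 p2.
  rewrite /bvec2 /bvec !mxE !inord_val !mxtens_indexK /= (can_eq (@mxtens_indexK _ _)).
  by rewrite xpair_eqE -natrM mulnb !ord1 !eqxx !andbT.
by rewrite -!colE => /matrixP/(_ i 0); rewrite !mxE.
Qed.

Section Sums.
Variable V : lmodType K.
Implicit Types F : nat -> V.

Lemma eq_position (P : pred nat) F G :
  (forall i, (0 < i <= N)%N -> P i -> F i = G i) ->
  \sum_(1 <= i < n.*2.+2 | P i) F i = \sum_(1 <= i < n.*2.+2 | P i) G i.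
Proof.
move=> FG; rewrite big_nat_cond [RHS]big_nat_cond.
by apply: eq_bigr => i /andP[/FG h /h].
Qed.

Lemma sum_position_delta (P : pred nat) F x : (0 < x <= N)%N ->
  \sum_(1 <= i < n.*2.+2 | P i) (i == x)%:R *: F i = (P x)%:R *: F x.
Proof.
move=> xN; rewrite big_mkcond (bigD1_seq x) ?iota_uniq ?mem_index_iota //= eqxx.
rewrite big1 ?addr0 => [|i ix]; first by case: ifP => _; rewrite ?scale1r ?scale0r.
by case: ifP => // _; rewrite (negbTE ix) scale0r.
Qed.

End Sums.

(** A common form for the sums over one index: [c] is the only index that can match v_a ⊗ v_b, and
    [q] is the condition on a and b that remains once i = c. *)
Lemma sum_EE_single (P : pred nat) (x x' y y' : nat -> nat) (q : bool) a b c :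
  (0 < a <= N)%N -> (0 < b <= N)%N -> (0 < c <= N)%N ->
  (forall i, (0 < i <= N)%N -> (0 < x' i <= N)%N && (0 < y' i <= N)%N) ->
  (forall i, (0 < i <= N)%N -> (x' i == a) && (y' i == b) = (i == c) && q) ->
  (\sum_(1 <= i < n.*2.+2 | P i) E (x i) (x' i) *t E (y i) (y' i)) *m bvec2 a b =
  (P c && q)%:R *: bvec2 (x c) (y c).
Proof.
move=> aN bN cN xyN xyq; rewrite mulmx_suml (@eq_position _ _ _
  (fun i => (i == c)%:R *: (q%:R *: bvec2 (x i) (y i)))) => [|i iN _]; last first.
  have /andP[xN yN] := xyN i iN.
  by rewrite EE_bvec2 // !scalerA -!natrM !mulnb xyq.
by rewrite sum_position_delta // scalerA -natrM mulnb.
Qed.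

Lemma sum_EE_swap1 (P : nat -> pred nat) a b : (0 < a <= N)%N -> (0 < b <= N)%N ->
  (\sum_(1 <= i < n.*2.+2) \sum_(1 <= j < n.*2.+2 | P i j) E i j *t E j i) *m bvec2 a b =
  (P b a)%:R *: bvec2 b a.
Proof.
move=> aN bN; rewrite mulmx_suml (@eq_position _ _ _
  (fun i => (i == b)%:R *: ((P i a)%:R *: bvec2 i a))) => [|i iN _]; last first.
  rewrite mulmx_suml (@eq_position _ _ _
    (fun j => (j == a)%:R *: ((i == b)%:R *: bvec2 i j))) => [|j jN _]; last first.
    by rewrite EE_bvec2.
  by rewrite sum_position_delta // !scalerA mulrC.
by rewrite sum_position_delta // scale1r.
Qed.

Lemma sum_EE_swap2 (P : nat -> pred nat) a b : (0 < a <= N)%N -> (0 < b <= N)%N ->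
  (\sum_(1 <= i < n.*2.+2) \sum_(1 <= j < n.*2.+2 | P i j) E j i *t E i j) *m bvec2 a b =
  (P a b)%:R *: bvec2 b a.
Proof.
move=> aN bN; rewrite mulmx_suml (@eq_position _ _ _
  (fun i => (i == a)%:R *: ((P i b)%:R *: bvec2 b i))) => [|i iN _]; last first.
  rewrite mulmx_suml (@eq_position _ _ _
    (fun j => (j == b)%:R *: ((i == a)%:R *: bvec2 j i))) => [|j jN _]; last first.
    by rewrite EE_bvec2 // !scalerA mulrC.
  by rewrite sum_position_delta // !scalerA mulrC.
by rewrite sum_position_delta // scale1r.
Qed.

Lemma sum_EE_order a b : (0 < a <= N)%N -> (0 < b <= N)%N ->
  (\sum_(1 <= i < n.*2.+2) \sum_(1 <= j < n.*2.+2 | (j < i)%N) E i i *t E j j) *m bvec2 a b =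
  (b < a)%N%:R *: bvec2 a b.
Proof.
move=> aN bN; rewrite mulmx_suml (@eq_position _ _ _
  (fun i => (i == a)%:R *: ((b < i)%N%:R *: bvec2 i b))) => [|i iN _]; last first.
  rewrite mulmx_suml (@eq_position _ _ _
    (fun j => (j == b)%:R *: ((i == a)%:R *: bvec2 i j))) => [|j jN _]; last first.
    by rewrite EE_bvec2 // !scalerA mulrC.
  by rewrite sum_position_delta // !scalerA mulrC.
by rewrite sum_position_delta // scale1r.
Qed.

Lemma sum_EE_contract (F : nat -> nat -> K) a b : (0 < a <= N)%N -> (0 < b <= N)%N ->
  (\sum_(1 <= i < n.*2.+2) \sum_(1 <= j < n.*2.+2 | (j < i)%N)
     F i j *: (E i (pr n j) *t E (pr n i) j)) *m bvec2 a b =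
  (a + b == n.*2.+2)%N%:R *:
    \sum_(1 <= i < n.*2.+2 | (b < i)%N) F i b *: bvec2 i (pr n i).
Proof.
move=> aN bN; rewrite mulmx_suml scaler_sumr [RHS]big_mkcond; apply: eq_position => i iN _.
rewrite mulmx_suml (@eq_position _ _ _
  (fun j => (j == b)%:R *: ((a + j == n.*2.+2)%N%:R *: (F i j *: bvec2 i (pr n i))))) => [|j jN _].
  by rewrite sum_position_delta //; case: ifP => _; rewrite ?scale1r ?scale0r.
rewrite -scalemxAl EE_bvec2 //; last by rewrite /pr; lia.
rewrite (_ : (pr n j == a) = (a + j == n.*2.+2)%N); last by rewrite /pr; lia.
by rewrite !scalerA; congr (_ *: _); ring.
Qed.

Lemma sum_E_diag (P : pred nat) m M a : (0 < m)%N -> (M <= n.*2.+2)%N -> (0 < a <= N)%N ->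
  (\sum_(m <= j < M | P j) E j j) *m bvec a = (P a && (m <= a < M)%N)%:R *: bvec a.
Proof.
move=> m0 MN aN; rewrite mulmx_suml.
have -> : \sum_(m <= j < M | P j) E j j *m bvec a = \sum_(m <= j < M | P j) (j == a)%:R *: bvec j.
  by rewrite big_nat_cond [RHS]big_nat_cond; apply: eq_bigr => j /andP[jm _]; rewrite E_bvec //; lia.
rewrite big_mkcond /=; case: (boolP (m <= a < M)%N) => ma; last first.
  rewrite andbF scale0r big1_seq // => j /=; rewrite mem_index_iota => jm.
  by case: eqP => [ja|_]; [move: ma; rewrite -ja jm | rewrite scale0r; case: ifP].
rewrite andbT (bigD1_seq a) ?iota_uniq ?mem_index_iota //= eqxx scale1r.
rewrite big1 ?addr0 => [|j ja]; first by case: ifP => _; rewrite ?scale1r ?scale0r.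
by rewrite (negbTE ja) scale0r; case: ifP.
Qed.

End Vectors.

(** * The generators on the basis vectors of V *)

Section Representation.
Variables (n : nat) (K : fieldType) (r s sqr sqs sqrs : K).
Hypotheses (n2 : (2 <= n)%N).
Variable rho : {lrmorphism U n r s -> 'M[K]_(n.*2.+1)}.
Hypothesis hrho : vector_rep sqr sqs sqrs rho.
Local Notation N := n.*2.+1.
Local Notation fc := (fcoef n r s sqr sqs sqrs).
Implicit Types a b c : nat.

Lemma rho_f_bvec (i : 'I_n) b : (0 < b <= N)%N ->
  rho (uf r s i) *m bvec n K b = fc i b *: bvec n K b.+1.
Proof.
move=> bN; have ni := ltn_ord i; rewrite /fcoef; case: ifP => [/eqP n_i|/eqP n_i].
  rewrite (vec_fn hrho) // -scalemxAl mulmxBl -!scalemxAl !E_bvec //; try (rewrite /pr; lia).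
  rewrite [n == b]eq_sym [n.+1 == b]eq_sym.
  case: eqVneq => [->|bn].
    by rewrite -[n == n.+1]/(n == n.+1) (ltn_eqF (ltnSn n)) scale0r scaler0 subr0 scale1r scalerA.
  case: eqVneq => [->|bn'].
    rewrite scale0r scaler0 sub0r scale1r scalerN scalerA scaleNr.
    by congr (- (_ *: bvec n K _)); rewrite /pr; lia.
  by rewrite !scale0r !scaler0 subrr scaler0.
rewrite (vec_f hrho); last lia.
rewrite mulmxBl -scalemxAl !E_bvec //; try (rewrite /pr; lia).
rewrite [i.+1 == b]eq_sym [pr n i.+2 == b]eq_sym.
case: eqVneq => [->|bn].
  rewrite (_ : (i.+1 == pr n i.+2) = false); last by rewrite /pr; lia.
  by rewrite scale0r scaler0 subr0.
case: eqVneq => [->|bn'].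
  rewrite scale0r sub0r scale1r scaleNr.
  by congr (- (_ *: bvec n K _)); rewrite /pr; lia.
by rewrite /= !mulr0n !scale0r scaler0 subrr.
Qed.

Lemma E_diag_bvec a b : (0 < a <= N)%N -> (0 < b <= N)%N ->
  E a a *m bvec n K b = (a == b)%:R *: bvec n K b.
Proof. by move=> aN bN; rewrite E_bvec //; case: eqVneq => [->|_]; rewrite ?scale0r. Qed.

Lemma omega_mx_bvec x y (i : nat) b : (i.+1 < n)%N -> (0 < b <= N)%N ->
  omega_mx n x y i.+1 *m bvec n K b = ev n x y i b *: bvec n K b.
Proof.
move=> ni bN; rewrite /omega_mx !mulmxDl -!scalemxAl sum_E_diag //.
rewrite !E_diag_bvec //; try (rewrite /pr; lia).
rewrite !scalerA -!scalerDl !natr_if !inE /ev /pr; congr (_ *: _).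
have andE (p q : bool) : p && q = if p then q else false by [].
have orE (p q : bool) : p || q = if p then true else q by [].
rewrite !(andE, orE) {andE orE} !if_neg.
by case_ifs; ring.
Qed.

Lemma omega_n_mx_bvec x y (i : nat) b : i.+1 = n -> (0 < b <= N)%N ->
  omega_n_mx n x y *m bvec n K b = ev n x y i b *: bvec n K b.
Proof.
move=> ni bN; rewrite /omega_n_mx !mulmxDl -!scalemxAl !sum_E_diag //; try (rewrite /pr; lia).
rewrite !E_diag_bvec //; try (rewrite /pr; lia).
rewrite !scalerA -!scalerDl !natr_if /ev /pr; congr (_ *: _).
have andE (p q : bool) : p && q = if p then q else false by [].
rewrite !andE {andE}.
by case_ifs; ring.
Qed.

Lemma rho_w_bvec (i : 'I_n) b : (0 < b <= N)%N ->
  rho (uw r s i) *m bvec n K b = ev n r s i b *: bvec n K b.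
Proof.
move=> bN; have ni := ltn_ord i; case: (eqVneq i.+1 n) => [n_i|n_i].
  by rewrite (vec_wn hrho) // (omega_n_mx_bvec _ _ n_i).
by rewrite (vec_w hrho) ?omega_mx_bvec //; lia.
Qed.

Lemma rho_wp_bvec (i : 'I_n) b : (0 < b <= N)%N ->
  rho (uwp r s i) *m bvec n K b = ev n s r i b *: bvec n K b.
Proof.
move=> bN; have ni := ltn_ord i; case: (eqVneq i.+1 n) => [n_i|n_i].
  by rewrite (vec_wpn hrho) // (omega_n_mx_bvec _ _ n_i).
by rewrite (vec_wp hrho) ?omega_mx_bvec //; lia.
Qed.

Lemma upper_E a b : (0 < a)%N -> (a < b <= N)%N -> upper 1 (E a b : 'M[K]_N).
Proof. by move=> a0 abN; apply: upper_delta; rewrite !inordK; lia. Qed.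

Lemma rho_e_upper (i : 'I_n) : upper 1 (rho (ue r s i)).
Proof.
have ni := ltn_ord i; case: (eqVneq i.+1 n) => [n_i|n_i].
  rewrite (vec_en hrho) // -scaleNr; apply/upper_scale/upper_lin; first by apply/upper_scale/upper_E; lia.
  by apply: upper_E; rewrite /pr; lia.
rewrite (vec_e hrho); last lia.
by rewrite -scaleNr; apply: upper_lin; apply: upper_E; rewrite /pr; lia.
Qed.

Lemma upper_bvec1 (A : 'M[K]_N) : upper 1 A -> A *m bvec n K 1 = 0.
Proof.
by move=> uA; rewrite -colE; apply/matrixP => a b; rewrite !mxE uA //= inordK // addn1.
Qed.

Lemma rho_e_bvec1 (i : 'I_n) : rho (ue r s i) *m bvec n K 1 = 0.
Proof. exact/upper_bvec1/rho_e_upper. Qed.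

End Representation.

(** * The weight operator composed with the flip *)

Section LeadingCoefficient.
Variables (n : nat) (K : fieldType) (r s sqr sqs sqrs : K).
Hypotheses (r0 : r != 0) (s0 : s != 0) (rps : r + s != 0) (n2 : (2 <= n)%N).
Hypotheses (sqrE : sqr ^+ 2 = r) (sqsE : sqs ^+ 2 = s) (sqrsE : sqrs ^+ 2 = r + s).
Local Notation N := n.*2.+1.
Local Notation fc := (fcoef n r s sqr sqs sqrs).
Local Notation cl l m := (@cst_lattice n K r s l m).
Implicit Types a b c : nat.

Lemma wt_step (i : 'I_n) b : fc i b != 0 ->
  forall j : 'I_n, wt b j = wt b.+1 j + (j == i)%:Z.
Proof.
move=> /(fcoef_neq0 (ltn_ord i)) fb j; have ni := ltn_ord i; have nj := ltn_ord j.
rewrite !wt_if -val_eqE /=; move: fb; rewrite /pr.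
by case: ifP => n_i fb; case: eqP => ? /=; case_ifs; lia.
Qed.

(** Passing from v_a to v_(a+1) lowers the weight by alpha_i, so bimultiplicativity changes the
    constant by one row product, which [prod_cst_wt_r] identifies as an eigenvalue. *)
Lemma cst_lattice_stepl (i : 'I_n) a b : (0 < b <= N)%N -> fc i a != 0 ->
  (cl (wt a.+1) (wt b))^-1 * ev n s r i b = (cl (wt a) (wt b))^-1.
Proof.
move=> bN fa; rewrite -[ev n s r i b]invrK -(prod_cst_wt_r r0 s0 i bN) -invfM; congr (_^-1).
rewrite /cst_lattice [RHS](bigD1 i) // [in LHS](bigD1 i) //= mulrAC; congr (_ * _).
  rewrite -big_split /=; apply: eq_bigr => j _.
  by rewrite (wt_step fa) eqxx mulrDl mul1r expfzDr ?cst_neq0.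
apply: eq_bigr => i' ii; apply: eq_bigr => j _.
by rewrite (wt_step fa) (negbTE ii) addr0.
Qed.

Lemma cst_lattice_stepr (i : 'I_n) a b : (0 < a <= N)%N -> fc i b != 0 ->
  (cl (wt a) (wt b.+1))^-1 = (cl (wt a) (wt b))^-1 * ev n r s i a.
Proof.
move=> aN fb; rewrite -[RHS]invrK -[LHS]invrK; congr (_^-1).
rewrite invfM !invrK; apply: (@mulIf _ (ev n r s i a)); first exact: ev_neq0.
rewrite mulfVK ?ev_neq0 // -(prod_cst_wt_l r0 s0 i aN) /cst_lattice -big_split /=.
apply: eq_bigr => i' _; rewrite (bigD1 i) //= [RHS](bigD1 i) //= mulrAC.
rewrite (wt_step fb) eqxx mulrDr mulr1 expfzDr ?cst_neq0 //; congr (_ * _).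
apply: eq_bigr => j ji; by rewrite (wt_step fb) (negbTE ji) addr0.
Qed.

(** Both sides obey the same recursion from a+1 to a and equal 1 at a = n+1, where the weight is
    zero; the induction descends from n+1 to 1. *)
Lemma cst_lattice_lead1 b : (0 < b <= N)%N -> (cl (wt 1) (wt b))^-1 = lead n r s 1 b.
Proof.
move=> bN.
suff H m a : (a + m = n.+1)%N -> (0 < a)%N -> (cl (wt a) (wt b))^-1 = lead n r s a b.
  by apply: (H n).
elim: m a => [|m IH] a am a0.
  have -> : a = n.+1 by lia.
  rewrite /lead eqxx /cst_lattice big1 ?invr1 // => i _; apply: big1 => j _.
  by rewrite /wt ltnn eqxx mul0r expr0z.
have an : (a.-1 < n)%N by lia.
pose i := Ordinal an.
have q0 : sqr != 0 by move: r0; rewrite -sqrE expf_eq0.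
have q1 : sqs != 0 by move: s0; rewrite -sqsE expf_eq0.
have q2 : sqrs != 0 by move: rps; rewrite -sqrsE expf_eq0.
have fa : fc i a != 0.
  rewrite /fcoef /= prednK // eqxx.
  by case: ifP => [->|_]; rewrite ?oner_neq0 ?mulf_neq0 ?invr_eq0 ?mulf_neq0.
rewrite -(cst_lattice_stepl bN fa) IH //; last lia.
by apply: lead_step fa => //; lia.
Qed.

Lemma ftilde_flip_bvec2 a b : (0 < a <= N)%N -> (0 < b <= N)%N ->
  ftilde n r s *m flip n K *m bvec2 n K a b = (cl (wt a) (wt b))^-1 *: bvec2 n K b a.
Proof.
move=> aN bN; rewrite -mulmxA flipE ftildeE.
by rewrite !inordK ?prednK //; lia.
Qed.

Variable rho : {lrmorphism U n r s -> 'M[K]_(n.*2.+1)}.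
Hypothesis hrho : vector_rep sqr sqs sqrs rho.

Lemma f_copr_bvec2 (i : 'I_n) (x : K) w a b : (0 < a <= N)%N -> (0 < b <= N)%N ->
  w *m bvec n K b = x *: bvec n K b ->
  (1%:M *t rho (uf r s i) + rho (uf r s i) *t w) *m bvec2 n K a b =
  fc i b *: bvec2 n K a b.+1 + (fc i a * x) *: bvec2 n K a.+1 b.
Proof.
move=> aN bN wb; rewrite mulmxDl !tensmx_mul mul1mx wb !(rho_f_bvec n2 hrho) //.
by rewrite tensmxZl !tensmxZr scalerA.
Qed.

Lemma ftilde_flip_intertwines (i : 'I_n) :
  (1%:M *t rho (uf r s i) + rho (uf r s i) *t rho (uw r s i)) *m (ftilde n r s *m flip n K) =
  ftilde n r s *m flip n K *m (1%:M *t rho (uf r s i) + rho (uf r s i) *t rho (uwp r s i)).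
Proof.
apply: bvec2_ext => a b aN bN.
rewrite -[LHS]mulmxA ftilde_flip_bvec2 // -scalemxAr.
rewrite (f_copr_bvec2 i bN aN (rho_w_bvec n2 hrho i aN)).
rewrite -[RHS]mulmxA (f_copr_bvec2 i aN bN (rho_wp_bvec n2 hrho i bN)) mulmxDr -!scalemxAr.
(* At c = N the symbol v_(c+1) is only a default value of [inord], so basis formulas are applied
   only where its coefficient is nonzero. *)
have step c : (0 < c <= N)%N -> fc i c != 0 -> (0 < c.+1 <= N)%N.
  by move=> cN; apply: contraR => cN'; rewrite fcoef_ge //; lia.
rewrite scalerDr !scalerA addrC; congr (_ + _).
  have [->|fb] := eqVneq (fc i b) 0; first by rewrite mul0r mulr0 !scale0r.
  rewrite ftilde_flip_bvec2 ?step // scalerA (cst_lattice_stepr aN fb).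
  by congr (_ *: _); ring.
have [->|fa] := eqVneq (fc i a) 0; first by rewrite mulr0 mul0r !scale0r.
rewrite ftilde_flip_bvec2 ?step // scalerA -(cst_lattice_stepl bN fa).
by congr (_ *: _); ring.
Qed.

End LeadingCoefficient.

(** * The closed form commutes with every F_i *)

Section Tail.
Variables (n : nat) (K : fieldType) (sqr sqs : K).
Local Notation N := n.*2.+1.
Local Notation qp := (qpow n sqr sqs).
Local Notation t := (bvec2 n K).
Implicit Types b : nat.

(** Truncation of the telescoping vector to the indices above b; up to the factor 1 / qp b it is the
    image of v_(b') ⊗ v_b under the last double sum of the closed form. *)
Definition tail b : 'M[K]_(N * N, 1 * 1) :=
  \sum_(1 <= i < n.*2.+2 | (b < i)%N) qp i *: t i (pr n i).

Lemma tail_ge b : (n.*2.+1 <= b)%N -> tail b = 0.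
Proof.
move=> Nb; rewrite /tail big_nat_cond big_pred0 // => i; lia.
Qed.

Lemma tail_step b : (0 < b <= n.*2)%N -> tail b = qp b.+1 *: t b.+1 (pr n b.+1) + tail b.+1.
Proof.
move=> bN; rewrite /tail !(big_mkcond (fun i => _ < i)%N) /=.
have bI : b.+1 \in index_iota 1 n.*2.+2 by rewrite mem_index_iota; lia.
rewrite !(bigD1_seq b.+1 bI (iota_uniq _ _)) /=.
rewrite ltnSn ltnn add0r; congr (_ + _); apply: eq_bigr => i ib.
by rewrite (_ : (b < i)%N = (b.+1 < i)%N) //; lia.
Qed.

End Tail.

Section ClosedForm.
Variables (n : nat) (K : fieldType) (r s sqr sqs sqrs : K).
Hypotheses (r0 : r != 0) (s0 : s != 0) (rps : r + s != 0) (n2 : (2 <= n)%N).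
Hypotheses (sqrE : sqr ^+ 2 = r) (sqsE : sqs ^+ 2 = s) (sqrsE : sqrs ^+ 2 = r + s).
Local Notation N := n.*2.+1.
Local Notation fc := (fcoef n r s sqr sqs sqrs).
Local Notation qp := (qpow n sqr sqs).
Local Notation ld := (lead n r s).
Local Notation ew := (ev n s r).
Local Notation t := (bvec2 n K).
Local Notation tail := (tail n sqr sqs).
Local Notation k := (r^-1 * s - r * s^-1).
Implicit Types a b c : nat.

Definition R_closed : 'M[K]_(N * N) :=
    (r^-1 * s) *: (\sum_(1 <= i < n.*2.+2 | i != pr n i) E i i *t E i i)
    + (r^-1 * s^-1) *:
        (\sum_(1 <= i < n.*2.+2) \sum_(1 <= j < n.*2.+2 | setA n i j)
            E i j *t E j i
         + \sum_(1 <= i < n.*2.+2) \sum_(1 <= j < n.*2.+2 | setB n i j)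
            E j i *t E i j)
    + (r * s) *:
        (\sum_(1 <= i < n.*2.+2) \sum_(1 <= j < n.*2.+2 | setA n i j)
            E j i *t E i j
         + \sum_(1 <= i < n.*2.+2) \sum_(1 <= j < n.*2.+2 | setB n i j)
            E i j *t E j i)
    + \sum_(1 <= i < n.*2.+2 | i != pr n i) E i n.+1 *t E n.+1 i
    + \sum_(1 <= j < n.*2.+2 | j != pr n j) E n.+1 j *t E j n.+1
    + (r * s^-1) *:
        (\sum_(1 <= i < n.*2.+2 | i != pr n i) E (pr n i) i *t E i (pr n i))
    + (r^-1 * s - r * s^-1) *:
        (\sum_(1 <= i < n.*2.+2) \sum_(1 <= j < n.*2.+2 | (j < i)%N)
            E i i *t E j j
         - \sum_(1 <= i < n.*2.+2) \sum_(1 <= j < n.*2.+2 | (j < i)%N)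
            ((sqr^-1 * sqs) ^ (rho2 n i - rho2 n j)) *:
              (E i (pr n j) *t E (pr n i) j))
    + E n.+1 n.+1 *t E n.+1 n.+1.

Let u0 : sqr^-1 * sqs != 0.
Proof.
have q0 : sqr != 0 by move: r0; rewrite -sqrE expf_eq0.
have q1 : sqs != 0 by move: s0; rewrite -sqsE expf_eq0.
by rewrite mulf_neq0 ?invr_eq0.
Qed.

Lemma qpow_neq0 c : qp c != 0. Proof. exact: expfz_neq0. Qed.

Lemma R_closed_bvec2 a b : (0 < a <= N)%N -> (0 < b <= N)%N ->
  R_closed *m t a b = ld a b *: t b a + (k * (b < a)%N%:R) *: t a b
    - (k * (a + b == n.*2.+2)%N%:R / qp b) *: tail b.
Proof.
move=> aN bN; rewrite /R_closed !mulmxDl -!scalemxAl !mulmxDl mulNmx.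
have -> : (\sum_(1 <= i < n.*2.+2 | i != pr n i) E i i *t E i i) *m t a b =
    ((a != pr n a) && (a == b))%:R *: t a a.
  apply: (@sum_EE_single n K _ id id id id _ a b a) => // i; first by move=> ->.
  by case: (eqVneq i a) => //= ->.
have -> : (\sum_(1 <= i < n.*2.+2 | i != pr n i) E i n.+1 *t E n.+1 i) *m t a b =
    ((b != pr n b) && (n.+1 == a))%:R *: t b n.+1.
  apply: (@sum_EE_single n K _ id (fun=> n.+1) (fun=> n.+1) id _ a b b) => // i; first lia.
  by move=> _; rewrite andbC.
have -> : (\sum_(1 <= i < n.*2.+2 | i != pr n i) E n.+1 i *t E i n.+1) *m t a b =
    ((a != pr n a) && (n.+1 == b))%:R *: t n.+1 a.
  by apply: (@sum_EE_single n K _ (fun=> n.+1) id id (fun=> n.+1) _ a b a) => // i; lia.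
have -> : (\sum_(1 <= i < n.*2.+2 | i != pr n i) E (pr n i) i *t E i (pr n i)) *m t a b =
    ((a != pr n a) && (pr n a == b))%:R *: t (pr n a) a.
  apply: (@sum_EE_single n K _ (pr n) id id (pr n) _ a b a) => // i.
    by rewrite /pr; lia.
  by case: (eqVneq i a) => //= ->.
rewrite !sum_EE_swap1 // !sum_EE_swap2 // sum_EE_order // sum_EE_contract //.
rewrite EE_bvec2 //; try lia.
have tailE : \sum_(1 <= i < n.*2.+2 | (b < i)%N)
    (sqr^-1 * sqs) ^ (rho2 n i - rho2 n b) *: t i (pr n i) = (qp b)^-1 *: tail b.
  rewrite scaler_sumr; apply: eq_bigr => i _; rewrite scalerA; congr (_ *: _).
  by rewrite expfzDr // -invr_expz mulrC.
rewrite tailE (lead_sum r0 s0 rps aN bN).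
(* Each exchange-type term is put on the common vector v_b ⊗ v_a, so that [lead_sum] collects all
   coefficients. *)
have t1 : ((a != pr n a) && (a == b))%:R *: t a a = ((b == a) && (a != pr n a))%:R *: t b a.
  by rewrite andbC [a == b]eq_sym; case: eqVneq => [->|] //=; rewrite !scale0r.
have t2 : ((a != pr n a) && (pr n a == b))%:R *: t (pr n a) a =
    ((b == pr n a) && (a != pr n a))%:R *: t b a.
  by rewrite andbC [pr n a == b]eq_sym; case: eqVneq => [->|] //=; rewrite !scale0r.
have t3 : ((b != pr n b) && (n.+1 == a))%:R *: t b n.+1 =
    ((a == n.+1) && (b != pr n b))%:R *: t b a.
  by rewrite andbC [n.+1 == a]eq_sym; case: eqVneq => [->|] //=; rewrite !scale0r.
have t4 : ((a != pr n a) && (n.+1 == b))%:R *: t n.+1 a =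
    ((b == n.+1) && (a != pr n a))%:R *: t b a.
  by rewrite andbC [n.+1 == b]eq_sym; case: eqVneq => [->|] //=; rewrite !scale0r.
have t5 : (n.+1 == a)%:R *: ((n.+1 == b)%:R *: t n.+1 n.+1) =
    ((a == n.+1) && (b == n.+1))%:R *: t b a.
  rewrite [n.+1 == a]eq_sym [n.+1 == b]eq_sym.
  by case: eqVneq => [->|] /=; case: eqVneq => [->|]; rewrite /= ?scale1r ?scale0r ?scaler0.
rewrite t1 t2 t3 t4 t5; apply/matrixP => i j; rewrite !mxE; ring.
Qed.

Lemma ev_pr (i b : nat) : (i < n)%N -> (0 < b <= N)%N -> ew i b * ew i (pr n b) = 1.
Proof.
clear sqrE sqsE sqrsE u0; move=> ni bN; rewrite /ev /pr; case_ifs; field; rewrite ?r0 ?s0 //.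
Qed.

Lemma fcoef_eq0 (i b : nat) : (i < n)%N -> (b == 0%N) || (N <= b)%N -> fc i b = 0.
Proof.
move=> ni bN; apply/eqP; apply: contraT => /(fcoef_neq0 ni).
by case: ifP; rewrite /pr; lia.
Qed.

Lemma qpow_cancel (i c : nat) : (i < n)%N -> (0 < c <= N)%N ->
  qp c.+1 * fc i (pr n c.+1) + qp c * fc i c * ew i (pr n c) = 0.
Proof.
move=> ni cN; have [c2|c2] := leqP c n.*2; first by apply: qpow_telescope => //; lia.
rewrite !(fcoef_eq0 ni) ?mulr0 ?mul0r ?addr0 //; rewrite /pr; lia.
Qed.

Variable rho : {lrmorphism U n r s -> 'M[K]_(n.*2.+1)}.
Hypothesis hrho : vector_rep sqr sqs sqrs rho.
Local Notation Fop i := (1%:M *t rho (uf r s i) + rho (uf r s i) *t rho (uwp r s i)).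

(** Consecutive terms cancel, so only the boundary term created by the truncation at b remains. The
    induction descends from the empty tail at b = N. *)
Lemma f_copr_tail (i : 'I_n) b : (0 < b <= N)%N ->
  Fop i *m tail b = (qp b.+1 * fc i (pr n b.+1)) *: t b.+1 (pr n b).
Proof.
have [m] := ubnP (N - b); elim: m b => // m IH b bm bN.
have ni := ltn_ord i.
have [b2|b2] := leqP b n.*2; last first.
  by rewrite tail_ge // mulmx0 (fcoef_eq0 ni) ?mulr0 ?scale0r // /pr; lia.
have b1N : (0 < b.+1 <= N)%N by lia.
have pN : (0 < pr n b.+1 <= N)%N by rewrite /pr; lia.
rewrite tail_step; last lia.
rewrite mulmxDr -scalemxAr (f_copr_bvec2 n2 hrho i b1N pN (rho_wp_bvec n2 hrho i pN)) IH //; last lia.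
rewrite (_ : (pr n b.+1).+1 = pr n b); last by rewrite /pr; lia.
rewrite scalerDr !scalerA -addrA -scalerDl.
have -> : qp b.+1 * (fc i b.+1 * ew i (pr n b.+1)) + qp b.+2 * fc i (pr n b.+2) = 0.
  by rewrite -(qpow_cancel ni b1N); ring.
by rewrite scale0r addr0.
Qed.

(** On v_a ⊗ v_b the two sides match on [t b a.+1] by [lead_step]; the shifts of order indicators
    and tails all produce corrections along [t b.+1 a], and their total is the identity
    [lead_exchange]. *)
Lemma R_closed_intertwines (i : 'I_n) : R_closed *m Fop i = Fop i *m R_closed.
Proof.
apply: bvec2_ext => a b aN bN; have ni := ltn_ord i.
have Fab := f_copr_bvec2 n2 hrho i aN bN (rho_wp_bvec n2 hrho i bN).
have Fba := f_copr_bvec2 n2 hrho i bN aN (rho_wp_bvec n2 hrho i aN).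
rewrite -[LHS]mulmxA Fab -[RHS]mulmxA R_closed_bvec2 // mulmxDr.
rewrite [RHS]mulmxBr [Fop i *m (_ + _)]mulmxDr -!scalemxAr Fab Fba f_copr_tail //.
have step c : (0 < c <= N)%N -> fc i c != 0 -> (0 < c.+1 <= N)%N.
  by move=> cN; apply: contraR => cN'; rewrite fcoef_ge //; lia.
have -> : fc i b *: (R_closed *m t a b.+1) = fc i b *: (ld a b.+1 *: t b.+1 a +
    (k * (b.+1 < a)%N%:R) *: t a b.+1 - (k * (a + b == N)%N%:R / qp b.+1) *: tail b.+1).
  have [->|fb] := eqVneq (fc i b) 0; first by rewrite !scale0r.
  by rewrite R_closed_bvec2 ?step // addnS eqSS.
have -> : (fc i a * ew i b) *: (R_closed *m t a.+1 b) = (fc i a * ew i b) *: (ld a.+1 b *: t b a.+1 +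
    (k * (b < a.+1)%N%:R) *: t a.+1 b - (k * (a + b == N)%N%:R / qp b) *: tail b).
  have [->|fa] := eqVneq (fc i a) 0; first by rewrite mul0r !scale0r.
  by rewrite R_closed_bvec2 ?step // addSn eqSS.
rewrite !scalerDr !scalerN !scalerA.
(* The indicators b+1 < a and b < a differ only at a = b+1, where [t a b.+1] and [t b.+1 a]
   coincide; likewise below at a = b. *)
have -> : (fc i b * (k * (b.+1 < a)%N%:R)) *: t a b.+1 =
    (fc i b * (k * (b < a)%N%:R)) *: t a b.+1 - (fc i b * k * (a == b.+1)%:R) *: t b.+1 a.
  case: (eqVneq a b.+1) => [->|ab].
    by rewrite ltnn ltnSn !mulr0 scale0r !mulr1 subrr.
  by rewrite mulr0 scale0r subr0 (_ : (b.+1 < a)%N = (b < a)%N) //; lia.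
have -> : (fc i a * ew i b * (k * (b < a.+1)%N%:R)) *: t a.+1 b =
    (fc i a * ew i b * (k * (b < a)%N%:R)) *: t a.+1 b
    + (fc i b * (k * ew i b * (a == b)%:R)) *: t b.+1 a.
  case: (eqVneq a b) => [->|ab].
    by rewrite ltnn ltnSn !mulr0 scale0r add0r !mulr1; congr (_ *: _); ring.
  by rewrite !mulr0 scale0r addr0 (_ : (b < a.+1)%N = (b < a)%N) //; lia.
have -> : (fc i b * (k * (a + b == N)%N%:R / qp b.+1)) *: tail b.+1 =
    - (fc i b * (k * (a + b == N)%N%:R)) *: t b.+1 a
    - (fc i a * ew i b * (k * (a + b == N)%N%:R / qp b)) *: tail b.
  case: (eqVneq (a + b)%N N) => [abN|_]; last by rewrite !(mulr0, mul0r, scale0r, oppr0, addr0).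
  have aE : a = pr n b.+1 by rewrite /pr; lia.
  have bN2 : (0 < b <= n.*2)%N by lia.
  rewrite (tail_step _ _ bN2) -aE.
  have tele := qpow_cancel ni bN.
  have evb := ev_pr ni bN.
  (* This is the cancellation relation at b, with a = (b+1)', solved by means of the eigenvalues on
     v_b and v_(b') being inverse to each other. *)
  have -> : fc i a * ew i b = - (fc i b * qp b / qp b.+1).
    apply: (mulfI (qpow_neq0 b.+1)).
    rewrite mulrA aE (_ : qp b.+1 * _ = - (qp b * fc i b * ew i (pr n b))).
      rewrite mulNr -[_ * ew i (pr n b) * _]mulrA [ew i _ * _]mulrC evb.
      by field; rewrite ?qpow_neq0 ?r0 ?s0.
    by apply/eqP; rewrite -addr_eq0 tele.
  move: (t b.+1 a) (tail b.+1) => T1 T2.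
  rewrite scalerDr scalerA; apply/matrixP => x y; rewrite !mxE.
  by field; rewrite ?qpow_neq0 ?r0 ?s0.
have -> : (k * (a + b == n.*2.+2)%N%:R / qp b * (qp b.+1 * fc i (pr n b.+1))) *: t b.+1 (pr n b) =
    - (fc i b * (k * ew i a * (a + b == n.*2.+2)%N%:R)) *: t b.+1 a.
  case: (eqVneq (a + b)%N n.*2.+2) => [abN|_]; last by rewrite !(mulr0, mul0r, scale0r, oppr0).
  have aE : a = pr n b by rewrite /pr; lia.
  rewrite -aE; congr (_ *: _).
  have -> : qp b.+1 * fc i (pr n b.+1) = - (qp b * fc i b * ew i a).
    by apply/eqP; rewrite -addr_eq0 aE (qpow_cancel ni bN).
  by field; rewrite ?qpow_neq0 ?r0 ?s0.
have -> : fc i a * ew i b * ld a.+1 b = ld a b * fc i a.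
  have [->|fa] := eqVneq (fc i a) 0; first by rewrite !mul0r mulr0.
  by rewrite -(lead_step r0 s0 rps ni aN bN fa); ring.
have -> : fc i b * ld a b.+1 = fc i b * (k * (a == b.+1)%:R - k * ew i b * (a == b)%:R
    - k * (a + b == N)%N%:R + ld a b * ew i a + k * ew i a * (a + b == n.*2.+2)%N%:R).
  have [->|fb] := eqVneq (fc i b) 0; first by rewrite !mul0r.
  congr (_ * _); apply/eqP; rewrite -subr_eq0 -(lead_exchange r0 s0 rps ni aN bN fb).
  by apply/eqP; ring.
move: (t b.+1 a) (t a b.+1) (t b a.+1) (t a.+1 b) (tail b) => T1 T2 T3 T4 T5.
by apply/matrixP => x y; rewrite !mxE; ring.
Qed.

End ClosedForm.

(** * Consequences of algebraic independence and the conclusion *)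

(** Independence is applied to the polynomial a X + b Y, with X the outer variable evaluated at r
    and Y the inner one at s. It supplies the nonvanishing of r, s, r + s and r - s. *)
Lemma alg_independent_lin (K : fieldType) (r s : K) (a b : int) :
  alg_independent r s -> (a != 0) || (b != 0) -> a%:~R * r + b%:~R * s != 0.
Proof.
case=> _ indep ab; pose p : {poly {poly rat}} := (a%:~R%:P)%:P * 'X + (b%:~R%:P * 'X)%:P.
have pE i : p`_i = if i == 0%N then b%:~R%:P * 'X else if i == 1%N then a%:~R%:P else 0.
  rewrite /p coefD coefMX coefC coefC; case: i => [|[|i]] /=; by rewrite ?add0r ?addr0.
have ratr0 : ratr 0 = 0 :> K := ratr_int K 0.
have map0 : map_poly (ratr : rat -> K) 0 = 0 by rewrite map_poly0.
have mapE : map_poly (map_poly ratr) p =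
    (a%:~R%:P)%:P * 'X + (b%:~R%:P * 'X)%:P :> {poly {poly K}}.
  apply/polyP => i; rewrite coef_map_id0 // pE coefD coefMX !coefC.
  case: i => [|[|i]] /=; rewrite ?add0r ?addr0 //; apply/polyP => j.
    rewrite coef_map_id0 // !coefMX !coefC; case: j => [|[|j]] //=; exact: ratr_int.
  by rewrite coef_map_id0 // !coefC; case: j => [|j] //=; exact: ratr_int.
have := indep p; rewrite mapE !(hornerD, hornerM, hornerC, hornerX); apply.
apply: contraTneq ab => p0; rewrite negb_or !negbK.
have /eqP := congr1 (fun q : {poly {poly rat}} => q`_1`_0) p0.
have /eqP := congr1 (fun q : {poly {poly rat}} => q`_0`_1) p0.
by rewrite !pE /= !coef0 coefMX coefC /= coefC /= !intr_eq0 => -> ->.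
Qed.

Theorem theorem3p10
    (n : nat) (hn : (2 <= n)%N)
    (K : fieldType) (r s : K) (hrs : alg_independent r s)
    (sqr sqs sqrs : K)
    (hsqr : sqr ^+ 2 = r) (hsqs : sqs ^+ 2 = s) (hsqrs : sqrs ^+ 2 = r + s)
    (Delta : {rmorphism U n r s -> tens (U n r s) (U n r s)})
    (hDelta : coproduct Delta)
    (phi : U n r s -> U n r s -> K) (hphi : skew_pairing Delta phi)
    (d : {ffun 'I_n -> nat} -> nat)
    (u v : forall z, 'I_(d z) -> U n r s)
    (hu : forall z, is_basis (U_plus z) (u z))
    (hv : forall z, is_basis (U_minus z) (v z))
    (huv : forall z k l, phi (v z k) (u z l) = (k == l)%:R)
    (rho : {lrmorphism U n r s -> 'M[K]_(n.*2.+1)})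
    (hrho : vector_rep sqr sqs sqrs rho) :
  R_VV rho u v =
    (r^-1 * s) *: (\sum_(1 <= i < n.*2.+2 | i != pr n i) E i i *t E i i)
    + (r^-1 * s^-1) *:
        (\sum_(1 <= i < n.*2.+2) \sum_(1 <= j < n.*2.+2 | setA n i j)
            E i j *t E j i
         + \sum_(1 <= i < n.*2.+2) \sum_(1 <= j < n.*2.+2 | setB n i j)
            E j i *t E i j)
    + (r * s) *:
        (\sum_(1 <= i < n.*2.+2) \sum_(1 <= j < n.*2.+2 | setA n i j)
            E j i *t E i j
         + \sum_(1 <= i < n.*2.+2) \sum_(1 <= j < n.*2.+2 | setB n i j)
            E i j *t E j i)
    + \sum_(1 <= i < n.*2.+2 | i != pr n i) E i n.+1 *t E n.+1 i
    + \sum_(1 <= j < n.*2.+2 | j != pr n j) E n.+1 j *t E j n.+1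
    + (r * s^-1) *:
        (\sum_(1 <= i < n.*2.+2 | i != pr n i) E (pr n i) i *t E i (pr n i))
    + (r^-1 * s - r * s^-1) *:
        (\sum_(1 <= i < n.*2.+2) \sum_(1 <= j < n.*2.+2 | (j < i)%N)
            E i i *t E j j
         - \sum_(1 <= i < n.*2.+2) \sum_(1 <= j < n.*2.+2 | (j < i)%N)
            ((sqr^-1 * sqs) ^ (rho2 n i - rho2 n j)) *:
              (E i (pr n j) *t E (pr n i) j))
    + E n.+1 n.+1 *t E n.+1 n.+1.
Proof.
have r0 : r != 0 by have := alg_independent_lin (a := 1) (b := 0) hrs isT; rewrite mul1r mul0r addr0.
have s0 : s != 0 by have := alg_independent_lin (a := 0) (b := 1) hrs isT; rewrite mul1r mul0r add0r.
have rps : r + s != 0 by have := alg_independent_lin (a := 1) (b := 1) hrs isT; rewrite !mul1r.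
have rms : r - s != 0 by have := alg_independent_lin (a := 1) (b := -1) hrs isT; rewrite mul1r mulN1r.
have n0 : (0 < n)%N by apply: leq_trans hn.
rewrite -/(R_closed n r s sqr sqs).
pose F i := 1%:M *t rho (uf r s i) + rho (uf r s i) *t rho (uwp r s i).
have RF i : R_VV rho u v *m F i = F i *m R_VV rho u v.
  rewrite /R_VV -[Theta_VV _ _ _ *m _ *m _]mulmxA -mulmxA /F.
  rewrite -(ftilde_flip_intertwines r0 s0 rps hn hrho) [LHS]mulmxA.
  by rewrite -(Theta_intertwines r0 s0 rms rps hDelta hphi hu hv huv (rho_e_upper hn hrho)) -!mulmxA.
have CF i := R_closed_intertwines r0 s0 rps hn hsqr hsqs hrho i.
pose D := R_VV rho u v - R_closed n r s sqr sqs.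
have DF i : D *m F i = F i *m D by rewrite mulmxBl mulmxBr RF CF.
apply/eqP; rewrite -subr_eq0 -/D; apply/eqP.
apply: bvec2_ext => a b; rewrite mul0mx; elim: a b => [//|a IH] b aN bN.
(* The induction variable is one less than the position, so a = 0 is the row of v_1. *)
case: (posnP a) => [a0|a0].
  rewrite a0 mulmxBl R_closed_bvec2 // /R_VV -!mulmxA.
  rewrite [ftilde _ _ _ *m _]mulmxA ftilde_flip_bvec2 // -scalemxAr.
  rewrite (Theta_highest rms rps n0 hDelta hphi hu hv huv (rho_e_upper hn hrho)); last first.
    exact: (rho_e_bvec1 hn hrho).
  rewrite (cst_lattice_lead1 r0 s0 rps hn hsqr hsqs hsqrs) //.
  rewrite (_ : (b < 1)%N = false); last lia.
  rewrite mulr0 scale0r addr0 opprB addrCA subrr addr0.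
  (* The contraction term needs 1 + b = 2n+2, that is b = N, and then its tail is empty. *)
  case: eqVneq => [ab|]; last by rewrite mulr0 mul0r scale0r.
  by rewrite tail_ge ?scaler0 //; lia.
have [|i ni fa] := fcoef_exists (b := a) r0 s0 rps hsqr hsqs hsqrs n0; first lia.
have a1N : (0 < a <= n.*2.+1)%N by lia.
pose j := Ordinal ni.
(* As D kills row a, applying D F = F D to v_a ⊗ v_b leaves only D(v_(a+1) ⊗ v_b), with the nonzero
   coefficient [fcoef] times an eigenvalue of omega'. *)
have := congr1 (fun M => M *m bvec2 n K a b) (DF j).
rewrite -[LHS]mulmxA -[RHS]mulmxA IH // mulmx0.
rewrite (f_copr_bvec2 hn hrho j a1N bN (rho_wp_bvec hn hrho j bN)) mulmxDr -!scalemxAr.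
have -> : fcoef n r s sqr sqs sqrs j b *: (D *m bvec2 n K a b.+1) = 0.
  have [->|fb] := eqVneq (fcoef n r s sqr sqs sqrs j b) 0; first by rewrite scale0r.
  have bN' : (0 < b.+1 <= n.*2.+1)%N.
    by move: fb; apply: contraR => bN'; rewrite fcoef_ge //; lia.
  by rewrite IH ?scaler0.
move/eqP; rewrite add0r scaler_eq0 mulf_eq0 (negbTE fa) (negbTE (ev_neq0 _ _ _ s0 r0)) /=.
by move/eqP.
Qed.
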